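(* The category $\mathcal{C}(numOp_{(g,n)})^{op}$ described in the context is quasi-Gröbner.
   Context: Quasi-Gröbner categories. Let $\mathcal{C}$ be a small category and $c$ an object. An admissible order on the morphisms out of $c$ is a choice, for every object $c'$, of a well-order on $\mathrm{Hom}(c,c')$ such that $f\prec f'$ implies $g\circ f\prec g\circ f'$ for all $g$. On morphisms out of $c$ put the preorder $f\le g$ iff $g=h\circ f$ for some $h$; $|c/\mathcal{C}|$ is the associated poset. A poset is Noetherian if every sequence $x_1,x_2,\dots$ has $i<j$ with $x_i\le x_j$. $\mathcal{C}$ is Gröbner if for every object $c$: (G1) morphisms out of $c$ admit an admissible order, and (G2) $|c/\mathcal{C}|$ is Noetherian. A functor $\Phi:\mathcal{C}\to\mathcal{D}$ has property (F) if for every object $d$ of $\mathcal{D}$ there are finitely many objects $c_i$ of $\mathcal{C}$ and morphisms $f_i:d\to\Phi(c_i)$ such that every $f:d\to\Phi(c)$ factors as $\Phi(g)\circ f_i$ for some $i$ and $g:c_i\to c$. $\mathcal{D}$ is quasi-Gröbner if there is a Gröbner $\mathcal{C}$ and an essentially surjective functor $\mathcal{C}\to\mathcal{D}$ with property (F). Operadic graphs. A graph with half-edges is finite sets $V$, $H$, an involution $inv$ on $H$ and $t:H\to V$; fixed points of $inv$ are leaves, two-element orbits are edges. An operadic graph additionally has a total order on leaves (indexed $0,1,\dots$), for each vertex $v$ a total order on $t^{-1}(v)$, and a total order on $V$ (indexed $1,\dots,n$); considered up to isomorphism preserving all data. The genus $g(\Gamma)$ of a connected graph is its first Betti number (#edges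 $-$ #vertices $+1$). The category $\mathcal{C}(numOp_{(g,n)})^{op}$: objects are connected operadic graphs with at least one vertex (loops, multiple edges and any number of leaves allowed), endowed with a genus map $g:V\to\mathbb{N}$. If $p$ has vertices $v_1<\dots<v_n$, a morphism $p\to q$ consists of objects $q_1,\dots,q_n$ such that $q_l$ has as many leaves as $v_l$ has half-edges and $g(v_l)=\sum_{v\in V(q_l)}g(v)+g(q_l)$, together with a bijection $\bigsqcup_l V(q_l)\to V(q)$ order preserving on each $V(q_l)$, such that $q$ is obtained by substituting $q_l$ into $v_l$: the $i$-th leaf of $q_l$ is identified with the $i$-th half-edge of $v_l$; an edge of $p$ between the $i$-th half-edge of $v_j$ and the $k$-th half-edge of $v_l$ becomes an edge of $q$ between the $i$-th leaf of $q_j$ and the $k$-th leaf of $q_l$; if the $i$-th half-edge of $v_j$ is the $k$-th leaf of $p$ then the $i$-th leaf of $q_j$ is the $k$-th leaf of $q$; half-edge orders and vertex genera come from the $q_l$, and the vertex order of $q$ is transported along the bijection. Composition is iterated substitution. (This is the opposite of $\mathcal{C}(P)$ for $P$ the operad of genus-graded modular operads, restricted to operations of non-zero arity.) *)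

(* Defs.v *)
From mathcomp Require Import all_boot.
From Stdlib Require List.
Set Implicit Arguments. Unset Strict Implicit. Unset Printing Implicit Defensive.

Record Category := Cat {
  Ob : Type;
  Hom : Ob -> Ob -> Type;
  cid : forall a, Hom a a;
  ccomp : forall a b c, Hom b c -> Hom a b -> Hom a c;
  ccompA : forall a b c d (h : Hom c d) (g : Hom b c) (f : Hom a b),
      @ccomp a c d h (@ccomp a b c g f) = @ccomp a b d (@ccomp b c d h g) f;
  ccomp1l : forall a b (f : Hom a b), @ccomp a b b (cid b) f = f;
  ccomp1r : forall a b (f : Hom a b), @ccomp a a b f (cid a) = f }.
Arguments Hom {_} _ _.
Arguments cid {_} _.
Arguments ccomp {_ _ _ _} _ _.

Definition admissible_order (C : Category) (c : Ob C)
    (lt : forall c' : Ob C, Hom c c' -> Hom c c' -> Prop) : Prop :=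
  (forall c' : Ob C,
      (forall f : Hom c c', ~ lt c' f f) /\
      (forall f g h : Hom c c', lt c' f g -> lt c' g h -> lt c' f h) /\
      (forall f g : Hom c c', f = g \/ lt c' f g \/ lt c' g f) /\
      well_founded (lt c')) /\
  (forall (c' c'' : Ob C) (g : Hom c' c'') (f f' : Hom c c'),
      lt c' f f' -> lt c'' (ccomp g f) (ccomp g f')).

Definition under_le (C : Category) (c : Ob C)
    (x y : {c' : Ob C & Hom c c'}) : Prop :=
  exists h : Hom (projT1 x) (projT1 y), projT2 y = ccomp h (projT2 x).

Definition noetherian_under (C : Category) (c : Ob C) : Prop :=
  forall s : nat -> {c' : Ob C & Hom c c'},
    exists i j, (i < j)%N /\ under_le (s i) (s j).

Definition groebner (C : Category) : Prop :=
  forall c : Ob C, (exists lt, @admissible_order C c lt) /\ noetherian_under c.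

(* Operadic graphs with genus map, in canonical form.                        *)
(* Since vertices and the half-edges at each vertex are totally ordered, an *)
(* isomorphism class is represented uniquely by: the list of vertex degrees, *)
(* the involution (half-edge (v,i) = i-th half-edge of the v-th vertex, both *)
(* 0-indexed), the list of leaves in their order, and the vertex genera.      *)
Record rgraph := RG {
  rdeg : seq nat;
  rinv : seq (seq (nat * nat));
  rleaves : seq (nat * nat);
  rgen : seq nat }.

Definition rg0 := RG [::] [::] [::] [::].
Definition nverts (r : rgraph) := size (rdeg r).
Definition deg (r : rgraph) (v : nat) := nth 0 (rdeg r) v.
Definition hinv (r : rgraph) (h : nat * nat) := nth (0,0) (nth [::] (rinv r) h.1) h.2.
Definition is_he (r : rgraph) (h : nat * nat) := (h.1 < nverts r) && (h.2 < deg r h.1).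
Definition hes (r : rgraph) : seq (nat * nat) :=
  flatten [seq [seq (v, i) | i <- iota 0 (deg r v)] | v <- iota 0 (nverts r)].

Definition adj (r : rgraph) : rel 'I_(nverts r) :=
  fun v w => has (fun i => (hinv r (val v, i)).1 == val w) (iota 0 (deg r v)).
Definition connectedb (r : rgraph) : bool :=
  [forall v : 'I_(nverts r), forall w : 'I_(nverts r), connect (@adj r) v w].

Definition validb (r : rgraph) : bool :=
  [&& 0 < nverts r, size (rinv r) == nverts r, size (rgen r) == nverts r,
      all (fun v => size (nth [::] (rinv r) v) == deg r v) (iota 0 (nverts r)),
      all (fun h => is_he r (hinv r h) && (hinv r (hinv r h) == h)) (hes r),
      uniq (rleaves r), all (is_he r) (rleaves r),
      all (fun h => (hinv r h == h) == (h \in rleaves r)) (hes r)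
    & connectedb r].

(* Objects of C(numOp_(g,n))^op: connected operadic graphs with >= 1 vertex
   and a genus map. *)
Definition ograph := {r : rgraph | validb r}.

(* First Betti number: #edges - #vertices + 1. *)
Definition genus (r : rgraph) : nat :=
  ((size (hes r) - size (rleaves r))./2 + 1) - nverts r.

(* Morphisms p -> q: the family q_1..q_n and the bijection                  *)
(* \sqcup_l V(q_l) -> V(q), order preserving on each V(q_l); such a bijection *)
(* is the same as the list [mcol] giving, for each vertex k of q, the index  *)
(* l of the q_l it comes from (it is the (rank)-th vertex of q_l).           *)
Record rmor := RM { mparts : seq rgraph; mcol : seq nat }.

Definition rank (c : seq nat) (k : nat) := count (pred1 (nth 0 c k)) (take k c).
Definition pos (c : seq nat) (l j : nat) :=
  nth 0 [seq k <- iota 0 (size c) | nth 0 c k == l] j.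

Definition subst (p : rgraph) (qs : seq rgraph) (c : seq nat) : rgraph :=
  let Q l := nth rg0 qs l in
  let part k := nth 0 c k in
  let img k i :=
    let l := part k in let j := rank c k in
    let h' := hinv (Q l) (j, i) in
    if h' != (j, i) then (pos c l h'.1, h'.2)      (* internal edge of q_l *)
    else                                           (* (j,i) is a leaf of q_l *)
      let r := index (j, i) (rleaves (Q l)) in
      let e := hinv p (l, r) in                    (* r-th half-edge of v_l *)
      if e != (l, r) then
        let h2 := nth (0,0) (rleaves (Q e.1)) e.2 in (pos c e.1 h2.1, h2.2)
      else (k, i) in                               (* stays a leaf *)
  RG [seq deg (Q (part k)) (rank c k) | k <- iota 0 (size c)]
     [seq [seq img k i | i <- iota 0 (deg (Q (part k)) (rank c k))]
          | k <- iota 0 (size c)]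
     [seq let h := nth (0,0) (rleaves (Q e.1)) e.2 in (pos c e.1 h.1, h.2)
          | e <- rleaves p]
     [seq nth 0 (rgen (Q (part k))) (rank c k) | k <- iota 0 (size c)].

Definition is_mor (p q : rgraph) (m : rmor) : Prop :=
  let Q l := nth rg0 (mparts m) l in
  [/\ size (mparts m) = nverts p,
      forall l, l < nverts p ->
        [/\ validb (Q l), size (rleaves (Q l)) = deg p l &
            nth 0 (rgen p) l = sumn (rgen (Q l)) + genus (Q l)],
      all (fun l => l < nverts p) (mcol m),
      forall l, l < nverts p -> count (pred1 l) (mcol m) = nverts (Q l)
    & q = subst p (mparts m) (mcol m)].

Definition Dhom (p q : ograph) := {m : rmor | is_mor (val p) (val q) m}.

Definition corolla (d g : nat) : rgraph :=
  RG [:: d] [:: [seq (0, i) | i <- iota 0 d]] [seq (0, i) | i <- iota 0 d] [:: g].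
Definition rid (p : rgraph) : rmor :=
  RM [seq corolla (deg p v) (nth 0 (rgen p) v) | v <- iota 0 (nverts p)]
     (iota 0 (nverts p)).

(* composite of f : p -> q and g : q -> r (iterated substitution):
   the l-th part is q_l with the r_k substituted (k ranging over the vertices
   of q coming from q_l). *)
Definition rcomp (f g : rmor) : rmor :=
  let qs := mparts f in let c := mcol f in
  let rs := mparts g in let c' := mcol g in
  RM [seq subst (nth rg0 qs l)
             [seq nth rg0 rs (pos c l j) | j <- iota 0 (nverts (nth rg0 qs l))]
             [seq rank c (nth 0 c' k)
                | k <- iota 0 (size c') & nth 0 c (nth 0 c' k) == l]
        | l <- iota 0 (size qs)]
     [seq nth 0 c (nth 0 c' k) | k <- iota 0 (size c')].

Definition is_functorD (C : Category) (F0 : Ob C -> ograph)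
    (F1 : forall a b : Ob C, Hom a b -> Dhom (F0 a) (F0 b)) : Prop :=
  (forall a : Ob C, proj1_sig (F1 a a (cid a)) = rid (val (F0 a))) /\
  (forall (a b c : Ob C) (g : Hom b c) (f : Hom a b),
      proj1_sig (F1 a c (ccomp g f)) = rcomp (proj1_sig (F1 a b f)) (proj1_sig (F1 b c g))).

Definition ess_surjD (C : Category) (F0 : Ob C -> ograph) : Prop :=
  forall d : ograph, exists (c : Ob C) (f : Dhom d (F0 c)) (g : Dhom (F0 c) d),
    rcomp (proj1_sig f) (proj1_sig g) = rid (val d) /\ rcomp (proj1_sig g) (proj1_sig f) = rid (val (F0 c)).

Definition propertyF_D (C : Category) (F0 : Ob C -> ograph)
    (F1 : forall a b : Ob C, Hom a b -> Dhom (F0 a) (F0 b)) : Prop :=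
  forall d : ograph, exists fs : seq {ci : Ob C & Dhom d (F0 ci)},
    forall (c : Ob C) (f : Dhom d (F0 c)),
      exists x, List.In x fs /\
        exists g : Hom (projT1 x) c,
          proj1_sig f = rcomp (proj1_sig (projT2 x)) (proj1_sig (F1 (projT1 x) c g)).

(* Main.v *)
(* A morphism p -> q amounts to a contraction of q onto p, that is, a map from
   the vertices of q to those of p together with an injection of the half-edges
   of p into those of q, and composition of morphisms is composition of these
   maps.  The Groebner category has as objects the graphs with a rooted plane
   spanning tree and an ordering of the remaining half-edges, and as morphisms
   the contractions, necessarily of tree edges only, that are compatible with
   the preorder of the vertices (on the first vertices of the fibres) and with
   the induced order of the half-edges.  These conditions make the
   lexicographic comparison of contractions an admissible order.

   Fix a graph d.  In the graphs q equipped with a morphism d -> q the number of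
   half-edges outside the spanning tree, the half-edges coming from d and the
   total genus are bounded, so the vertices of the spanning tree can be
   decorated with finitely many labels recording all these data.  A
   label-preserving Kruskal embedding of spanning trees then gives a contraction
   under d: every vertex is sent to the lowest vertex above it in the image of
   the embedding, so only edges of the tree carrying no label are contracted.
   Hence factorization through the Groebner category is a well-quasi-order on
   the morphisms out of d, which yields both (G2) and property (F). *)

Require Import Defs.
From mathcomp Require Import all_boot.
From mathcomp Require Import zify.
From Stdlib Require Import Classical ClassicalEpsilon.
Set Implicit Arguments. Unset Strict Implicit. Unset Printing Implicit Defensive.
(* fingraph also defines an [rgraph]. *)
Import Defs.

(** * Cutting out subgraphs *)

(** [rcomp] substitutes lists of graphs and renumbers them through [pos] and [rank], which makes its
    associativity opaque. Only one general computation with [subst] is made ([subst_sub]); through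
    [enc] and [dec] the rest concerns functions on vertices and half-edges, whose composition is
    associative for free. Morphisms nevertheless stay raw lists, because functions carry irrelevant
    values outside their range. The equation between the genus of a vertex and that of the graph
    substituted for it bounds the Betti numbers of the fibres, hence the edges outside a spanning
    tree. It does not bound the number of vertices: a fibre can be enlarged without end by genus 0
    vertices, for instance by subdividing an edge. This is why a theorem on trees is needed. Since
    Kruskal's theorem compares labels vertex by vertex, data of the whole graph must be repeated in
    every label. *)

Lemma mem_hes r h : (h \in hes r) = is_he r h.
Proof.
apply/flatten_mapP/idP => [[v]|].
  rewrite mem_iota /= add0n => vn /mapP[i]; rewrite mem_iota /= add0n => id ->.
  by rewrite /is_he vn.
case/andP=> h1 h2; exists h.1; first by rewrite mem_iota.
by apply/mapP; exists h.2; rewrite ?mem_iota //; case: (h).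
Qed.

Lemma uniq_hes r : uniq (hes r).
Proof.
rewrite /hes; elim: (iota 0 (nverts r)) (iota_uniq 0 (nverts r)) => //= v s IH /andP[vs us].
rewrite cat_uniq IH // andbT map_inj_uniq ?iota_uniq //=; last by move=> i j [].
apply/hasPn => h /flatten_mapP[w ws /mapP[i _ ->]].
by apply: contra vs => /mapP[j _ [<- _]].
Qed.

Lemma size_hes r : size (hes r) = \sum_(v <- iota 0 (nverts r)) deg r v.
Proof.
rewrite /hes size_flatten /shape -map_comp sumnE big_map.
by apply: eq_bigr => v _; rewrite /= size_map size_iota.
Qed.

Lemma eq_rgraph r s :
  size (rinv r) = nverts r -> size (rinv s) = nverts s ->
  size (rgen r) = nverts r -> size (rgen s) = nverts s ->
  (forall v, v < nverts r -> size (nth [::] (rinv r) v) = deg r v) ->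
  (forall v, v < nverts s -> size (nth [::] (rinv s) v) = deg s v) ->
  nverts r = nverts s ->
  (forall v, v < nverts r -> deg r v = deg s v) ->
  (forall h, is_he r h -> hinv r h = hinv s h) ->
  rleaves r = rleaves s ->
  (forall v, v < nverts r -> nth 0 (rgen r) v = nth 0 (rgen s) v) -> r = s.
Proof.
case: r s => [d1 i1 l1 g1] [d2 i2 l2 g2]; rewrite /nverts /deg /hinv /is_he /nverts /deg /=.
move=> si1 si2 sg1 sg2 n1 n2 sd ed ei -> eg.
have -> : d1 = d2 by apply: (@eq_from_nth _ 0).
have -> : g1 = g2 by apply: (@eq_from_nth _ 0) => [|v]; rewrite sg1 ?sg2 // => /eg.
congr (RG _ _ _ _); apply: (@eq_from_nth _ [::]) => [|v]; rewrite si1 ?si2 // => vn.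
have vn2 : v < size d2 by rewrite -sd.
have {}ed := ed v vn.
apply: (@eq_from_nth _ (0,0)) => [|i]; rewrite ?n1 ?n2 ?ed // => id.
by have := ei (v, i); rewrite /= vn ed id; apply.
Qed.

Section Valid.
Variable r : rgraph.

Record valid : Prop := Valid {
  valid_nverts : 0 < nverts r;
  valid_size_rinv : size (rinv r) = nverts r;
  valid_size_rgen : size (rgen r) = nverts r;
  valid_size_rinv_nth : forall v, v < nverts r -> size (nth [::] (rinv r) v) = deg r v;
  valid_hinv : forall h, is_he r h -> is_he r (hinv r h) /\ hinv r (hinv r h) = h;
  valid_uniq_leaves : uniq (rleaves r);
  valid_leaf_he : forall h, h \in rleaves r -> is_he r h;
  valid_leafE : forall h, is_he r h -> (hinv r h == h) = (h \in rleaves r);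
  valid_connected : connectedb r }.

Lemma validP : validb r <-> valid.
Proof.
split=> [|[H1 H2 H3 H4 H5 H6 H7 H8 H9]].
  case/and5P=> H1 /eqP H2 /eqP H3 /allP H4 /and5P[/allP H5 H6 /allP H7 /allP H8 H9].
  split=> // [v vn|h|h].
  - by apply/eqP/H4; rewrite mem_iota.
  - by rewrite -mem_hes => /H5/andP[? /eqP].
  - by rewrite -mem_hes => /H8/eqP.
rewrite /validb H1 H2 H3 H6 H9 !eqxx /= andbT; apply/and4P; split.
- by apply/allP => v; rewrite mem_iota /= add0n => /H4/eqP.
- by apply/allP => h; rewrite mem_hes => /H5[-> ->]; rewrite eqxx.
- exact/allP.
- by apply/allP => h; rewrite mem_hes => /H8 ->.
Qed.
End Valid.

(* The subgraph of [q] on the vertices [F], in which the half-edges [A] are cut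
   and become the leaves, in this order. *)
Definition sub (q : rgraph) (F : seq nat) (A : seq (nat * nat)) : rgraph :=
  let loc h := (index h.1 F, h.2) in
  RG [seq deg q k | k <- F]
     [seq [seq (if (k, i) \in A then loc (k, i) else loc (hinv q (k, i)))
            | i <- iota 0 (deg q k)] | k <- F]
     [seq loc h | h <- A]
     [seq nth 0 (rgen q) k | k <- F].

Section Sub.
Variables (q : rgraph) (F : seq nat) (A : seq (nat * nat)).
Let s := sub q F A.

Lemma nverts_sub : nverts s = size F. Proof. by rewrite /nverts size_map. Qed.
Lemma deg_sub k : k \in F -> deg s (index k F) = deg q k.
Proof. by move=> kF; rewrite /deg (nth_map 0) ?index_mem // nth_index. Qed.
Lemma rgen_sub k : k \in F -> nth 0 (rgen s) (index k F) = nth 0 (rgen q) k.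
Proof. by move=> kF; rewrite (nth_map 0) ?index_mem // nth_index. Qed.
Lemma hinv_sub k i : k \in F -> i < deg q k ->
  hinv s (index k F, i) =
    if (k, i) \in A then (index k F, i) else (index (hinv q (k, i)).1 F, (hinv q (k, i)).2).
Proof.
move=> kF id; rewrite /hinv /= (nth_map 0) ?index_mem // nth_index //.
by rewrite (nth_map 0) ?size_iota // nth_iota.
Qed.
Lemma size_rinv_sub : size (rinv s) = nverts s. Proof. by rewrite nverts_sub size_map. Qed.
Lemma size_rgen_sub : size (rgen s) = nverts s. Proof. by rewrite nverts_sub size_map. Qed.
Lemma size_rinv_nth_sub v : v < nverts s -> size (nth [::] (rinv s) v) = deg s v.
Proof.
by rewrite nverts_sub => vF; rewrite (nth_map 0) // size_map size_iota /deg (nth_map 0).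
Qed.
Lemma is_he_sub k i : k \in F -> is_he s (index k F, i) = (i < deg q k).
Proof. by move=> kF; rewrite /is_he /= nverts_sub index_mem kF deg_sub. Qed.
Lemma subP v : uniq F -> v < nverts s -> exists2 k, k \in F & v = index k F.
Proof.
rewrite nverts_sub => uF vF; exists (nth 0 F v); first exact: mem_nth.
by rewrite index_uniq.
Qed.
Lemma is_he_subP h : uniq F -> is_he s h ->
  exists k i, [/\ k \in F, i < deg q k & h = (index k F, i)].
Proof.
move=> uF; case: h => v i /[dup] /andP[/(subP uF)[k kF /= ->] _]; rewrite is_he_sub // => id.
by exists k, i.
Qed.
End Sub.

Lemma size_hes_sub q F A : uniq F -> size (hes (sub q F A)) = \sum_(k <- F) deg q k.
Proof.
move=> uF; rewrite size_hes nverts_sub -[in RHS](mkseq_nth 0 F) big_map /=.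
apply: eq_big_seq => j; rewrite mem_iota /= add0n => jF.
by rewrite -[j in deg _ j](index_uniq 0 jF uF) deg_sub ?mem_nth.
Qed.

Lemma index_inj_in (T : eqType) (F : seq T) x y : x \in F -> y \in F -> index x F = index y F -> x = y.
Proof. by move=> xF yF e; rewrite -(nth_index x xF) e nth_index. Qed.

(** When the colours are [map f F], [pos] and [rank] translate between indices in [F] and in its
    subsequence of colour [l]. Vertices can then be named by elements of [F] instead of by
    positions. *)
Lemma posE (f : nat -> nat) F l j : uniq F -> j < size [seq k <- F | f k == l] ->
  pos (map f F) l j = index (nth 0 [seq k <- F | f k == l] j) F.
Proof.
move=> uF jl; have E : [seq k <- F | f k == l] =
    map (nth 0 F) [seq k <- iota 0 (size (map f F)) | nth 0 (map f F) k == l].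
  rewrite size_map -{1}(mkseq_nth 0 F) /mkseq filter_map; congr map.
  by apply: eq_in_filter => k; rewrite mem_iota /= add0n => kF; rewrite (nth_map 0).
have js : j < size [seq k <- iota 0 (size (map f F)) | nth 0 (map f F) k == l].
  by move: jl; rewrite {1}E size_map.
rewrite E (nth_map 0) // index_uniq //.
have := mem_nth 0 js; rewrite mem_filter mem_iota size_map /= add0n.
by case/andP.
Qed.

Lemma rankE (f : nat -> nat) F k : uniq F -> k \in F ->
  rank (map f F) (index k F) = index k [seq j <- F | f j == f k].
Proof.
move=> uF kF; rewrite /rank (nth_map 0) ?index_mem // nth_index //.
case/splitPr: kF uF => p1 p2; rewrite cat_uniq /= negb_or => /and3P[_ /andP[kp _] _].
rewrite index_cat (negbTE kp) /= eqxx addn0 map_cat take_size_cat ?size_map //.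
rewrite filter_cat index_cat mem_filter (negbTE kp) andbF /= eqxx /= eqxx addn0.
by rewrite count_map size_filter.
Qed.

Lemma index_iota0 n k : k < n -> index k (iota 0 n) = k.
Proof. by move=> kn; rewrite -{1}[k](nth_iota 0 0 kn) index_uniq ?size_iota ?iota_uniq. Qed.

(** Leaves are fixed by the involution, so cutting at them alters nothing. *)
Lemma sub_id q : valid q -> sub q (iota 0 (nverts q)) (rleaves q) = q.
Proof.
move=> vq; set F := iota _ _.
have ixF k : k < nverts q -> index k F = k by exact: index_iota0.
have memF k : (k \in F) = (k < nverts q) by rewrite mem_iota.
apply: eq_rgraph; rewrite ?size_rinv_sub ?size_rgen_sub ?valid_size_rinv ?valid_size_rgen //.
- exact: size_rinv_nth_sub.
- by move=> v; exact: valid_size_rinv_nth.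
- by rewrite nverts_sub size_iota.
- by move=> v; rewrite nverts_sub size_iota => vn; rewrite -{1}(ixF v) // deg_sub ?memF.
- move=> h /is_he_subP[|k [i [kF id ->]]]; first exact: iota_uniq.
  rewrite hinv_sub //; rewrite memF in kF; rewrite ixF //.
  have hh : is_he q (k, i) by rewrite /is_he kF.
  case: ifP => [kl|_]; first by apply/esym/eqP; rewrite valid_leafE.
  by case/(valid_hinv vq): hh => /andP[h1 _] _; rewrite ixF //; case: (hinv _ _).
- rewrite -[RHS]map_id; apply/eq_in_map => h /(valid_leaf_he vq)/andP[h1 _].
  by rewrite ixF //; case: (h).
- by move=> v; rewrite nverts_sub size_iota => vn; rewrite -{1}(ixF v) // rgen_sub ?memF.
Qed.

(** For a morphism from [p] to [q] the two directions are opposite: [x.1] maps vertices of [q] to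
    those of [p], [x.2] maps half-edges of [p] to those of [q]. Both are total, with meaningless
    values elsewhere. *)
Definition cmap := ((nat -> nat) * (nat * nat -> nat * nat))%type.

Definition fibre (n : nat) (f : nat -> nat) l := [seq k <- iota 0 n | f k == l].
Definition legs (p : rgraph) (g : nat * nat -> nat * nat) l := [seq g (l, i) | i <- iota 0 (deg p l)].

Definition enc (p q : rgraph) (x : cmap) : rmor :=
  RM [seq sub q (fibre (nverts q) x.1 l) (legs p x.2 l) | l <- iota 0 (nverts p)]
     [seq x.1 k | k <- iota 0 (nverts q)].

Section SubstSub.
Variables (P r : rgraph) (F : seq nat) (f : nat -> nat) (g : nat * nat -> nat * nat).
Hypothesis uF : uniq F.
Hypothesis fF : forall k, k \in F -> f k < nverts P.
Hypothesis gF : forall e, is_he P e -> [/\ (g e).1 \in F, f (g e).1 = e.1 & (g e).2 < deg r (g e).1].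
Hypothesis gI : forall e e', is_he P e -> is_he P e' -> g e = g e' -> e = e'.
Hypothesis PI : forall e, is_he P e -> is_he P (hinv P e).
Hypothesis PL : forall e, is_he P e -> (hinv P e == e) = (e \in rleaves P).
Hypothesis PLh : forall e, e \in rleaves P -> is_he P e.
Hypothesis gV : forall e, is_he P e -> hinv P e != e -> hinv r (g e) = g (hinv P e).
Hypothesis fV : forall k i, k \in F -> i < deg r k -> (forall e, is_he P e -> g e != (k, i)) ->
  [/\ hinv r (k, i) != (k, i), (hinv r (k, i)).1 \in F & f (hinv r (k, i)).1 = f k].

(** Cutting [r] along the image of [g] and gluing the pieces according to [P] restores [r]: at an
    image of [g] the new involution comes from [P] and agrees with that of [r] by [gV]; any other
    edge stays inside one piece by [fV]. The list [F] lets the lemma serve both for a whole graph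
    and for a single fibre of a composite. *)
Lemma subst_sub :
  subst P [seq sub r [seq k <- F | f k == l] (legs P g l) | l <- iota 0 (nverts P)] (map f F)
    = sub r F (map g (rleaves P)).
Proof.
set qs := map _ (iota 0 (nverts P)).
pose Fl l := [seq k <- F | f k == l].
have Q l : l < nverts P -> nth rg0 qs l = sub r (Fl l) (legs P g l).
  by move=> lP; rewrite /qs (nth_map 0) ?size_iota // nth_iota.
have part k : k \in F -> nth 0 (map f F) (index k F) = f k.
  by move=> kF; rewrite (nth_map 0) ?index_mem // nth_index.
have rk k : k \in F -> rank (map f F) (index k F) = index k (Fl (f k)) by move=> kF; exact: rankE.
have Fl_mem k l : (k \in Fl l) = (f k == l) && (k \in F) by rewrite mem_filter.
have ps k l : k \in F -> f k = l -> pos (map f F) l (index k (Fl l)) = index k F.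
  move=> kF fk; have kl : k \in Fl l by rewrite Fl_mem fk eqxx.
  by rewrite posE ?index_mem // nth_index.
have legsP l h : l < nverts P ->
    reflect (exists2 e, is_he P e /\ e.1 = l & h = g e) (h \in legs P g l).
  move=> lP; apply: (iffP mapP) => [[i]|[[a b] [/andP[/= _ bd] /= al ->]]].
    by rewrite mem_iota /= add0n => il ->; exists (l, i) => //; rewrite /is_he /= lP.
  by exists b; rewrite -?al // mem_iota.
have leafk l i : is_he P (l, i) ->
    nth (0,0) (rleaves (sub r (Fl l) (legs P g l))) i = (index (g (l, i)).1 (Fl l), (g (l,i)).2).
  case/andP=> /= lP id; rewrite /= /legs -map_comp (nth_map 0) ?size_iota //.
  by rewrite nth_iota.
have gps e : is_he P e -> let h := nth (0,0) (rleaves (nth rg0 qs e.1)) e.2 in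
   (pos (map f F) e.1 h.1, h.2) = (index (g e).1 F, (g e).2).
  move=> he /=; case/andP: (he) => e1 e2; rewrite Q // [X in nth _ X _]/= .
  have := leafk e.1 e.2; rewrite -surjective_pairing => /(_ he) /= ->.
  by case: (gF he) => gF1 gF2 _; rewrite ps.
have Fix k : k \in F -> exists2 v, v < size F & k = nth 0 F v.
  by move=> kF; exists (index k F); rewrite ?index_mem ?nth_index.
have nS : nverts (subst P qs (map f F)) = size F by rewrite /nverts !size_map size_iota.
have degS k : k \in F -> deg (subst P qs (map f F)) (index k F) = deg r k.
  move=> kF; rewrite /deg /subst (nth_map 0) ?size_iota ?size_map ?index_mem //.
  rewrite nth_iota ?index_mem // add0n part // rk // Q ?fF //.
  by rewrite deg_sub // Fl_mem eqxx.
apply: eq_rgraph; rewrite ?size_rinv_sub ?size_rgen_sub //.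
- by rewrite nS !size_map size_iota.
- by rewrite nS !size_map size_iota.
- move=> v; rewrite nS => vF; rewrite /deg /= !(nth_map 0) ?size_iota ?size_map ?nth_iota //.
  - by rewrite size_iota.
  - by rewrite fF ?mem_nth.
  - by rewrite fF ?mem_nth.
- exact: size_rinv_nth_sub.
- by rewrite nS nverts_sub.
- move=> v; rewrite nS => vF; rewrite -(index_uniq 0 vF uF).
  by rewrite degS ?deg_sub ?mem_nth.
- case=> v i; rewrite /is_he /= nS => /andP[vF].
  rewrite -(index_uniq 0 vF uF); move: (nth 0 F v) (mem_nth 0 vF) => k kF {v vF}.
  rewrite degS // => id; rewrite hinv_sub //.
  rewrite {1}/hinv /subst /= (nth_map 0) ?size_iota ?size_map ?index_mem //.
  rewrite nth_iota ?index_mem // add0n part // rk // Q ?fF //.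
  have kFl : k \in Fl (f k) by rewrite Fl_mem eqxx.
  rewrite deg_sub // (nth_map 0) ?size_iota // nth_iota // add0n.
  (* A half-edge of [r] is either a leg, reglued through [P], or interior to its piece. *)
  rewrite hinv_sub //; case: (legsP (f k) (k, i) (fF kF)) => [[e [he e1] ge]|nleg].
    rewrite eqxx /=.
    (* The legs are distinct by [gI], so the leaf number found by [index] is the original number
       [e.2]. *)
    have -> : index (index k (Fl (f k)), i)
       [seq (index h.1 (Fl (f k)), h.2) | h <- legs P g (f k)] = e.2.
      have ue : uniq [seq (index h.1 (Fl (f k)), h.2) | h <- legs P g (f k)].
        rewrite /legs -map_comp map_inj_in_uniq ?iota_uniq // => a b.
        rewrite !mem_iota /= !add0n => ad bd [E1 E2].
        have ha : is_he P (f k, a) by rewrite /is_he /= fF.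
        have hb : is_he P (f k, b) by rewrite /is_he /= fF.
        case: (gF ha) (gF hb) => [a1 a2 a3] [b1 b2 b3].
        have E3 := index_inj_in _ _ E1; rewrite !Fl_mem a1 b1 a2 b2 eqxx in E3.
        have : g (f k, a) = g (f k, b).
          by rewrite [g _]surjective_pairing [g (_, b)]surjective_pairing E3 ?E2.
        by case/(gI ha hb).
      have e2d : e.2 < size [seq (index h.1 (Fl (f k)), h.2) | h <- legs P g (f k)].
        by rewrite !size_map size_iota -e1; case/andP: he.
      rewrite -[RHS](index_uniq (0,0) e2d ue); congr index.
      have := leafk e.1 e.2; rewrite -surjective_pairing => /(_ he) /=.
      by rewrite e1 => ->; rewrite -ge.
    rewrite -e1 -surjective_pairing; case: eqP => [eE|/eqP eN] /=.
      by rewrite ge map_f // -PL // eE.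
    rewrite gps ?PI // -gV //.
    rewrite -ge ifN //; apply/mapP => -[e' e'l]; rewrite ge => /gI E.
    by move: eN; rewrite PL // E ?e'l // PLh.
  have nim e : is_he P e -> g e != (k, i).
    move=> he; apply/eqP => E; apply: nleg; exists e => //; split=> //.
    by case: (gF he) => _ <- _; rewrite E.
  have [h1 h2 h3] := fV kF id nim.
  rewrite ifT; last first.
    apply/negP => /eqP[E1 E2]; case/negP: h1; apply/eqP.
    rewrite [LHS]surjective_pairing E2; congr (_, _).
    by apply: (@index_inj_in _ (Fl (f k))); rewrite // Fl_mem h3 eqxx.
  rewrite /= ps //; rewrite ifN //; apply/mapP => -[e /PLh /nim/eqP E E']; exact: E.
- rewrite /= -map_comp; apply/eq_in_map => e /PLh he.
  by rewrite gps.
- move=> v; rewrite nS => vF; rewrite -(index_uniq 0 vF uF).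
  have kF := mem_nth 0 vF; move: (nth 0 F v) kF => k kF.
  rewrite rgen_sub // /subst /= (nth_map 0) ?size_iota ?size_map ?index_mem //.
  rewrite nth_iota ?index_mem // add0n part // rk // Q ?fF //.
  by rewrite rgen_sub // Fl_mem eqxx.
Qed.
End SubstSub.

(** * Morphisms as contraction maps *)

Definition part (p q : rgraph) (x : cmap) l := sub q (fibre (nverts q) x.1 l) (legs p x.2 l).

Lemma mem_fibre n f l k : (k \in fibre n f l) = (f k == l) && (k < n).
Proof. by rewrite mem_filter mem_iota. Qed.

Lemma uniq_fibre n f l : uniq (fibre n f l).
Proof. by rewrite filter_uniq ?iota_uniq. Qed.

Lemma mem_legs p g l e : is_he p e -> e.1 = l -> g e \in legs p g l.
Proof.
case/andP=> _ e2 <-; apply/mapP; exists e.2; first by rewrite mem_iota.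
by case: (e).
Qed.

Lemma legsP p g l h : l < nverts p -> h \in legs p g l ->
  exists e, [/\ is_he p e, e.1 = l & h = g e].
Proof.
move=> lp /mapP[i]; rewrite mem_iota /= add0n => il ->.
by exists (l, i); rewrite /is_he /= lp.
Qed.

(** Nonemptiness, connectedness and genus of the fibres are required separately, of [part p q x l].
    [con_inv] is restricted to edges of [p]: leaves of [p] are covered by [con_leaves]. *)
Record contraction (p q : rgraph) (x : cmap) : Prop := Contraction {
  con_f : forall k, k < nverts q -> x.1 k < nverts p;
  con_g : forall e, is_he p e -> is_he q (x.2 e) /\ x.1 (x.2 e).1 = e.1;
  con_inj : forall e e', is_he p e -> is_he p e' -> x.2 e = x.2 e' -> e = e';
  con_inv : forall e, is_he p e -> hinv p e != e -> hinv q (x.2 e) = x.2 (hinv p e);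
  con_leaves : rleaves q = map x.2 (rleaves p);
  con_fib : forall h, is_he q h -> (forall e, is_he p e -> x.2 e != h) ->
    x.1 (hinv q h).1 = x.1 h.1 }.

Section Contraction.
Variables (p q : rgraph) (x : cmap).
Hypotheses (vp : valid p) (vq : valid q) (cx : contraction p q x).

(** The image of [x.2] is stable under the involution of [q] and contains all leaves, so its
    complement is a union of edges. *)
Lemma con_out h : is_he q h -> (forall e, is_he p e -> x.2 e != h) ->
  [/\ hinv q h != h, is_he q (hinv q h) & forall e, is_he p e -> x.2 e != hinv q h].
Proof.
move=> hh hn; have [hh' hK] := valid_hinv vq hh.
have nl e : e \in rleaves p -> x.2 e != h by move/(valid_leaf_he vp)/hn.
split=> // [|e he]; apply/negP.
  rewrite valid_leafE // (con_leaves cx) => /mapP[e /nl/eqP ne eE].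
  exact/ne/esym.
move/eqP=> eE; have [eI|eN] := eqVneq (hinv p e) e.
  have : x.2 e \in rleaves q.
    by rewrite (con_leaves cx) map_f // -(valid_leafE vp) // eI.
  rewrite -(valid_leafE vq); last by case: (con_g cx he).
  by rewrite eE hK eq_sym -eE; apply/negP/hn.
have := con_inv cx he eN; rewrite eE hK => E.
by case/valid_hinv: (he) => // he' _; move/eqP: (hn _ he'); apply.
Qed.

Lemma valid_part l : l < nverts p -> 0 < size (fibre (nverts q) x.1 l) ->
  connectedb (part p q x l) -> valid (part p q x l).
Proof.
move=> lp F0 conn; set F := fibre _ _ _ in F0; rewrite /part -/F.
have uF : uniq F by exact: uniq_fibre.
have FE k : (k \in F) = (x.1 k == l) && (k < nverts q) by exact: mem_fibre.
have heF k i : k \in F -> i < deg q k -> is_he q (k, i).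
  by rewrite FE => /andP[_ kn] id; rewrite /is_he kn.
have nleg h : l = x.1 h.1 -> h \notin legs p x.2 l -> forall e, is_he p e -> x.2 e != h.
  move=> e1 hN e he; apply: contra hN => /eqP E; rewrite -E; apply: mem_legs => //.
  by case: (con_g cx he) => _; rewrite E e1.
have inn k i : k \in F -> i < deg q k -> (k, i) \notin legs p x.2 l ->
  [/\ hinv q (k, i) != (k, i), is_he q (hinv q (k, i)), (hinv q (k, i)).1 \in F &
      hinv q (k, i) \notin legs p x.2 l].
  move=> kF id hN; have hh := heF _ _ kF id.
  have lE : l = x.1 k by move: kF; rewrite FE => /andP[/eqP].
  have N := nleg (k, i) lE hN; have [h1 h2 h3] := con_out hh N.
  split=> //; first by rewrite FE (con_fib cx hh N) -lE eqxx; case/andP: h2.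
  apply/negP => /(legsP lp)[e [he _ E]].
  by have := h3 _ he; rewrite E eqxx.
split=> //.
- by rewrite nverts_sub.
- exact: size_rinv_sub.
- exact: size_rgen_sub.
- exact: size_rinv_nth_sub.
- move=> h /(is_he_subP uF)[k [i [kF id ->]]]; rewrite hinv_sub //.
  have [kl|kl] := ifPn; first by rewrite is_he_sub // hinv_sub // kl.
  have [h1 /andP[h2 h2'] h3 h4] := inn _ _ kF id kl; rewrite is_he_sub // hinv_sub // h2'; split=> //.
  rewrite -surjective_pairing (negbTE h4).
  by have [_ ->] := valid_hinv vq (heF _ _ kF id).
- rewrite /= map_inj_in_uniq; last first.
    move=> a b /(legsP lp)[e [he e1 aE]] /(legsP lp)[e' [he' e1' bE]] [E1 E2].
    have [/andP[ge _] fe] := con_g cx he; have [/andP[ge' _] fe'] := con_g cx he'.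
    have {}E1 := index_inj_in _ _ E1.
    rewrite [a]surjective_pairing [b]surjective_pairing E2 E1 //.
      by rewrite FE aE ge fe e1 eqxx.
    by rewrite FE bE ge' fe' e1' eqxx.
  rewrite map_inj_in_uniq ?iota_uniq // => a b; rewrite !mem_iota /= !add0n => al bl.
  have [ha hb] : is_he p (l, a) /\ is_he p (l, b) by rewrite /is_he /= lp.
  by case/(con_inj cx ha hb).
- move=> h /mapP[h' /(legsP lp)[e [he e1 ->]] ->].
  have [/andP[ge ge'] fe] := con_g cx he.
  by rewrite is_he_sub // FE fe e1 eqxx.
- move=> h /(is_he_subP uF)[k [i [kF id ->]]]; rewrite hinv_sub //.
  have [kl|kl] := ifPn; first by rewrite eqxx; apply/esym/mapP; exists (k, i).
  have [h1 h2 h3 h4] := inn _ _ kF id kl.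
  have -> : ((index k F, i) \in rleaves (sub q F (legs p x.2 l))) = false.
    apply/mapP => -[h0 hl [E1 E2]]; case/negP: kl; move: (hl).
    have [e [he e1 hE]] := legsP lp hl.
    have [/andP[ge _] fe] := con_g cx he.
    have -> : k = h0.1 by apply: index_inj_in E1; rewrite // FE hE fe e1 eqxx.
    by rewrite E2 -surjective_pairing.
  apply/negP => /eqP[E1 E2]; case/negP: h1; apply/eqP.
  by rewrite [LHS]surjective_pairing E2 (index_inj_in _ _ E1).
Qed.

Lemma subst_enc : subst p (mparts (enc p q x)) (mcol (enc p q x)) = q.
Proof.
rewrite /= subst_sub; first by rewrite -(con_leaves cx) sub_id.
- exact: iota_uniq.
- by move=> k; rewrite mem_iota => /(con_f cx).
- by move=> e /(con_g cx)[/andP[h1 h2] h3]; rewrite mem_iota.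
- exact: con_inj cx.
- by move=> e /(valid_hinv vp)[].
- exact: valid_leafE.
- exact: valid_leaf_he.
- exact: con_inv.
- move=> k i; rewrite mem_iota /= add0n => kn id N.
  have hh : is_he q (k, i) by rewrite /is_he kn.
  have [h1 /andP[h2 _] _] := con_out hh N; split=> //; first by rewrite mem_iota.
  exact: con_fib cx _ hh N.
Qed.

Hypothesis parts : forall l, l < nverts p -> valid (part p q x l) /\
  nth 0 (rgen p) l = sumn (rgen (part p q x l)) + genus (part p q x l).

Lemma is_mor_enc : is_mor p q (enc p q x).
Proof.
split.
- by rewrite /= size_map size_iota.
- move=> l lp; rewrite /= (nth_map 0) ?size_iota // nth_iota //; have [v g] := parts lp.
  split=> //; first exact/validP.
  by rewrite /= !size_map size_iota.
- by apply/allP => v /mapP[k]; rewrite mem_iota /= => /(con_f cx) lt ->.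
- move=> l lp; rewrite /= (nth_map 0) ?size_iota // nth_iota //.
  by rewrite nverts_sub size_filter count_map.
- by rewrite subst_enc.
Qed.
End Contraction.

(** Only these values enter [enc], so no equality of functions is ever needed. *)
Lemma eq_enc p q x y : (forall k, k < nverts q -> x.1 k = y.1 k) ->
  (forall e, is_he p e -> x.2 e = y.2 e) -> enc p q x = enc p q y.
Proof.
move=> e1 e2; rewrite /enc; congr RM; last first.
  by apply/eq_in_map => k; rewrite mem_iota => /e1.
apply/eq_in_map => l; rewrite mem_iota /= add0n => lp; congr sub.
  by apply: eq_in_filter => k; rewrite mem_iota => /e1 ->.
by apply/eq_in_map => i; rewrite mem_iota => il; rewrite e2 // /is_he /= lp.
Qed.

(** * Composition of contraction maps *)

Definition ccmp (y x : cmap) : cmap := (x.1 \o y.1, y.2 \o x.2).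

Lemma contraction_comp p q r x y : valid p -> valid q -> contraction p q x -> contraction q r y ->
  contraction p r (ccmp y x).
Proof.
move=> vp vq cx cy; split=> /=.
- by move=> k /(con_f cy)/(con_f cx).
- move=> e he; have [h1 h2] := con_g cx he.
  by have [h3 ->] := con_g cy h1.
- move=> e e' he he' /(con_inj cy) E; apply: (con_inj cx) => //; apply: E.
    by case: (con_g cx he).
  by case: (con_g cx he').
- move=> e he hN; have [h1 _] := con_g cx he.
  have E := con_inv cx he hN; rewrite -E; apply: (con_inv cy) => //.
  rewrite E; apply: contra hN => /eqP/(con_inj cx) -> //.
  by case: (valid_hinv vp he).
- by rewrite (con_leaves cy) (con_leaves cx) -map_comp.
(* A half-edge missed by the composite is the image under [y] of one missed by [x], or is itself
   missed by [y]. *)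
- move=> h hh N; case: (boolP (has (fun e => y.2 e == h) (hes q))) => [/hasP[e]|/hasPn N'].
    rewrite mem_hes => he /eqP E; rewrite -E.
    have Ne e' : is_he p e' -> x.2 e' != e.
      by move=> he'; apply: contraNneq (N _ he') => ->; rewrite E.
    have [e1 e2 e3] := con_out vp vq cx he Ne.
    rewrite (con_inv cy) // (con_g cy e2).2 (con_g cy he).2.
    exact: con_fib cx _ he Ne.
  congr x.1; apply: (con_fib cy) => // e; rewrite -mem_hes; exact: N'.
Qed.

(** The [l]-th part of the composite substitutes fibres of [y] into the fibre [Fl] of [x]. This is
    [subst_sub] with [P] the part of [x] and [F] the fibre of the composite; [f] and [g] below are
    [y] after renumbering [Fl] by positions. *)
Lemma rcomp_enc p q r x y : valid p -> valid q -> valid r ->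
  contraction p q x -> contraction q r y ->
  (forall l, l < nverts p -> valid (part p q x l)) ->
  rcomp (enc p q x) (enc q r y) = enc p r (ccmp y x).
Proof.
move=> vp vq vr cx cy parts; rewrite /rcomp /=; congr RM; last first.
  rewrite [size _]size_map size_iota; apply/eq_in_map => k; rewrite mem_iota /= add0n => kn.
  by rewrite !(nth_map 0) ?size_iota ?nth_iota ?(con_f cy).
rewrite [size (map _ (iota 0 (nverts p)))]size_map size_iota.
apply/eq_in_map => l; rewrite mem_iota /= add0n => lp.
rewrite (nth_map 0) ?size_iota // nth_iota // add0n -/(part p q x l).
have vP := parts _ lp; set P := part p q x l in vP *.
pose Fl := fibre (nverts q) x.1 l; pose F := fibre (nverts r) (x.1 \o y.1) l.
have uFl : uniq Fl by exact: uniq_fibre.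
have FlE k : (k \in Fl) = (x.1 k == l) && (k < nverts q) by exact: mem_fibre.
have FE k : (k \in F) = (x.1 (y.1 k) == l) && (k < nverts r) by exact: mem_fibre.
pose f k := index (y.1 k) Fl; pose g (h : nat * nat) := y.2 (nth 0 Fl h.1, h.2).
have nP : nverts P = size Fl by rewrite nverts_sub.
have yF k : k \in F -> y.1 k \in Fl.
  by rewrite FE FlE => /andP[-> /(con_f cy)].
have heP h : is_he P h -> exists k i, [/\ k \in Fl, is_he q (k, i), h = (index k Fl, i) & g h = y.2 (k, i)].
  move=> /(is_he_subP uFl)[k [i [kF id ->]]]; exists k, i; split=> //.
    by rewrite /is_he id; move: kF; rewrite FlE => /andP[_ ->].
  by rewrite /g /= nth_index.
have pcol : [seq rank [seq x.1 k | k <- iota 0 (nverts q)]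
        (nth 0 [seq y.1 k | k <- iota 0 (nverts r)] k)
      | k <- iota 0 (size [seq y.1 k | k <- iota 0 (nverts r)])
      & nth 0 [seq x.1 i | i <- iota 0 (nverts q)]
          (nth 0 [seq y.1 i | i <- iota 0 (nverts r)] k) == l] = map f F.
  rewrite size_map size_iota.
  have -> : [seq k <- iota 0 (nverts r) | nth 0 [seq x.1 i | i <- iota 0 (nverts q)]
     (nth 0 [seq y.1 i | i <- iota 0 (nverts r)] k) == l] = F.
    apply: eq_in_filter => k; rewrite mem_iota /= add0n => kn.
    by rewrite !(nth_map 0) ?size_iota ?nth_iota ?(con_f cy).
  apply/eq_in_map => k; rewrite FE => /andP[/eqP kl kn].
  rewrite (nth_map 0) ?size_iota ?nth_iota // add0n.
  have ykn := con_f cy kn; rewrite -{1}(index_iota0 ykn) rankE ?iota_uniq ?mem_iota //.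
  by rewrite kl.
have pparts : [seq nth rg0 [seq sub r (fibre (nverts r) y.1 l0) (legs q y.2 l0) | l0 <- iota 0 (nverts q)]
            (pos [seq x.1 k | k <- iota 0 (nverts q)] l j) | j <- iota 0 (nverts P)] =
    [seq sub r [seq k <- F | f k == j] (legs P g j) | j <- iota 0 (nverts P)].
  apply/eq_in_map => j; rewrite mem_iota nP /= add0n => jl.
  have jF : nth 0 Fl j \in Fl by exact: mem_nth.
  have jq : nth 0 Fl j < nverts q by move: jF; rewrite FlE => /andP[].
  rewrite posE ?iota_uniq // -/(fibre _ _ _) -/Fl index_iota0 //.
  rewrite (nth_map 0) ?size_iota // nth_iota // add0n; congr sub.
    rewrite -filter_predI; apply: eq_in_filter => k; rewrite mem_iota /= add0n => kn.
    apply/eqP/andP => [E|[/eqP E1 E2]].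
      move: jF; rewrite FlE -E => /andP[xy _]; rewrite xy; split=> //.
      by rewrite /f E index_uniq.
    by rewrite -E1 /f nth_index // yF // FE E2.
  have -> : legs P g j = [seq g (j, i) | i <- iota 0 (deg q (nth 0 Fl j))] => //.
  by rewrite /legs -[j in deg P j](index_uniq 0 jl uFl) /P /part deg_sub.
rewrite pcol pparts subst_sub //.
- rewrite /P /= -map_comp /legs -map_comp; congr sub; apply/eq_in_map => i.
  rewrite mem_iota /= add0n => il; rewrite /g /=.
  have he : is_he p (l, i) by rewrite /is_he /= lp.
  have [/andP[h1 _] h2] := con_g cx he.
  by rewrite nth_index -?surjective_pairing // FlE h1 h2 eqxx.
- exact: uniq_fibre.
- by move=> k /yF kF; rewrite nP index_mem.
- move=> e /heP[k [i [kF hki -> ->]]]; have [/andP[h1 h2] h3] := con_g cy hki.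
  split=> //; last by rewrite /f h3.
  by move: kF; rewrite FE FlE h3 => /andP[-> _].
- move=> e e' /heP[k [i [kF hki -> ->]]] /heP[k' [i' [kF' hki' -> ->]]].
  by case/(con_inj cy hki hki') => -> ->.
- by move=> e /(valid_hinv vP)[].
- exact: valid_leafE.
- exact: valid_leaf_he.
- move=> e /heP[k [i [kF hki -> ->]]]; have /andP[/= _ id] := hki.
  rewrite hinv_sub //; case: ifP => [_|/negbT kl] eN; first by rewrite eqxx in eN.
  have Ne e' : is_he p e' -> x.2 e' != (k, i).
    move=> he'; apply: contra kl => /eqP E; rewrite -E; apply: mem_legs => //.
    by have [_] := con_g cx he'; rewrite E; move: kF; rewrite FlE => /andP[/eqP ->].
  have [h1 h2 _] := con_out vp vq cx hki Ne.
  rewrite (con_inv cy) // /g /= nth_index -?surjective_pairing //.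
  rewrite FlE (con_fib cx hki Ne); case/andP: h2 => ->; rewrite andbT.
  by move: kF; rewrite FlE => /andP[].
- move=> k i kF id N; have /andP[xy kn] : (x.1 (y.1 k) == l) && (k < nverts r) by rewrite -FE.
  have hki : is_he r (k, i) by rewrite /is_he kn.
  have N' e : is_he q e -> y.2 e != (k, i).
    move=> he; apply/eqP => E.
    have e1 : e.1 = y.1 k by have [_ <-] := con_g cy he; rewrite E.
    have e1F : e.1 \in Fl by rewrite e1 yF.
    have /andP[_ e2] := he.
    have := N (index e.1 Fl, e.2); rewrite is_he_sub // => /(_ e2).
    by rewrite /g /= nth_index // -surjective_pairing E eqxx.
  have [h1 /andP[h2 _] _] := con_out vq vr cy hki N'; have E := con_fib cy hki N'.
  split=> //; first by rewrite FE E xy h2.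
  by rewrite /f E.
Qed.

(** * From morphisms back to contraction maps *)

Definition dec (m : rmor) : cmap :=
  (nth 0 (mcol m), fun e => let h := nth (0, 0) (rleaves (nth rg0 (mparts m) e.1)) e.2 in
                            (pos (mcol m) e.1 h.1, h.2)).

Lemma dec_enc_f p q x k : k < nverts q -> (dec (enc p q x)).1 k = x.1 k.
Proof. by move=> kq; rewrite /= (nth_map 0) ?size_iota ?nth_iota. Qed.

Lemma dec_enc_g p q x e : contraction p q x -> is_he p e -> (dec (enc p q x)).2 e = x.2 e.
Proof.
move=> cx he; have /andP[e1 e2] := he.
have [/andP[h1 h2] h3] := con_g cx he.
have eF : (x.2 e).1 \in fibre (nverts q) x.1 e.1 by rewrite mem_fibre h3 eqxx h1.
have xe : x.2 (e.1, e.2) = x.2 e by rewrite -surjective_pairing.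
rewrite /= (nth_map 0) ?size_iota // nth_iota // add0n /= (nth_map (0,0)) ?size_map ?size_iota //.
rewrite /legs (nth_map 0) ?size_iota // nth_iota // add0n /= xe.
by rewrite posE ?index_mem ?iota_uniq // nth_index // index_iota0 // -surjective_pairing.
Qed.

Section Dec.
Variables (p q : rgraph) (m : rmor).
Hypothesis mm : is_mor p q m.
Let Q l := nth rg0 (mparts m) l.
Let c := mcol m.
Let F l := fibre (size c) (nth 0 c) l.

Let sQ : size (mparts m) = nverts p. Proof. by case: mm. Qed.
Let vQ l : l < nverts p -> valid (Q l).
Proof. by case: mm => _ H _ _ _ /H[/validP]. Qed.
Let lQ l : l < nverts p -> size (rleaves (Q l)) = deg p l.
Proof. by case: mm => _ H _ _ _ /H[]. Qed.
Let gQ l : l < nverts p -> nth 0 (rgen p) l = sumn (rgen (Q l)) + genus (Q l).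
Proof. by case: mm => _ H _ _ _ /H[]. Qed.
Let cp k : k < size c -> nth 0 c k < nverts p.
Proof. by move=> kc; case: mm => _ _ /allP H _ _; apply: H; rewrite mem_nth. Qed.
Let qE : q = subst p (mparts m) c. Proof. by case: mm. Qed.
Let nq : nverts q = size c. Proof. by rewrite qE /nverts size_map size_iota. Qed.

Let cE : c = map (nth 0 c) (iota 0 (size c)). Proof. by rewrite -/(mkseq _ _) mkseq_nth. Qed.
Let uF l : uniq (F l). Proof. exact: uniq_fibre. Qed.
Let FE l k : (k \in F l) = (nth 0 c k == l) && (k < size c). Proof. exact: mem_fibre. Qed.
Let nF l : l < nverts p -> nverts (Q l) = size (F l).
Proof.
by move=> lp; case: mm => _ _ _ /(_ l lp) <- _; rewrite -/c {1}cE count_map size_filter.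
Qed.
Let rankF k : k < size c -> rank c k = index k (F (nth 0 c k)).
Proof.
by move=> kc; rewrite {1}cE -{1}(index_iota0 kc) rankE ?iota_uniq ?mem_iota // mem_iota.
Qed.
Let rankn l j : l < nverts p -> j < nverts (Q l) ->
  let k := nth 0 (F l) j in [/\ k < size c, nth 0 c k = l & rank c k = j].
Proof.
move=> lp jl; rewrite nF // in jl; have := mem_nth 0 jl; rewrite FE => /andP[/eqP kl kc].
by split=> //; rewrite rankF // kl index_uniq.
Qed.
Let degF l j : l < nverts p -> j < nverts (Q l) -> deg q (nth 0 (F l) j) = deg (Q l) j.
Proof.
move=> lp jl; have [kc kl kr] := rankn lp jl.
by rewrite qE /deg /= (nth_map 0) ?size_iota // nth_iota // add0n kl kr.
Qed.
Let genF l j : l < nverts p -> j < nverts (Q l) ->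
  nth 0 (rgen q) (nth 0 (F l) j) = nth 0 (rgen (Q l)) j.
Proof.
move=> lp jl; have [kc kl kr] := rankn lp jl.
by rewrite qE /= (nth_map 0) ?size_iota // nth_iota // add0n kl kr.
Qed.
Let lift l (h : nat * nat) := (nth 0 (F l) h.1, h.2).
Let leg l i := nth (0, 0) (rleaves (Q l)) i.
Let legE l i : l < nverts p -> i < deg p l ->
  [/\ leg l i \in rleaves (Q l), is_he (Q l) (leg l i) & (dec m).2 (l, i) = lift l (leg l i)].
Proof.
move=> lp il; have H : leg l i \in rleaves (Q l) by rewrite mem_nth ?lQ.
by have hh := valid_leaf_he (vQ lp) H; split.
Qed.
Let lift_he l h : l < nverts p -> is_he (Q l) h -> is_he q (lift l h).
Proof.
move=> lp /andP[h1 h2]; rewrite /is_he /= degF // h2 andbT nq.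
by have [] := rankn lp h1.
Qed.
Let heqP h : is_he q h -> exists l h', [/\ l < nverts p, is_he (Q l) h', h = lift l h' & l = nth 0 c h.1].
Proof.
case: h => k i /= /andP[/= kq id]; rewrite nq in kq; have lp := cp kq.
have kF : k \in F (nth 0 c k) by rewrite FE eqxx.
have jF : index k (F (nth 0 c k)) < nverts (Q (nth 0 c k)) by rewrite nF // index_mem.
have knth : nth 0 (F (nth 0 c k)) (index k (F (nth 0 c k))) = k by rewrite nth_index.
exists (nth 0 c k), (index k (F (nth 0 c k)), i); split=> //; last by rewrite /lift /= knth.
by rewrite /is_he jF /= -degF // knth.
Qed.
Let lift_inj l h h' : l < nverts p -> is_he (Q l) h -> is_he (Q l) h' -> lift l h = lift l h' -> h = h'.
Proof.
move=> lp /andP[h1 _] /andP[h1' _] [/eqP]; rewrite nth_uniq -?nF // => /eqP E1 E2.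
by rewrite [h]surjective_pairing E1 E2 -surjective_pairing.
Qed.
Let hinv_lift l h : l < nverts p -> is_he (Q l) h ->
  hinv q (lift l h) = if h \in rleaves (Q l) then
    let e := hinv p (l, index h (rleaves (Q l))) in
    if e != (l, index h (rleaves (Q l))) then (dec m).2 e else lift l h
  else lift l (hinv (Q l) h).
Proof.
move=> lp hh; have [h1 h2] := andP hh; have [kc kl kr] := rankn lp h1.
rewrite -(valid_leafE (vQ lp) hh) {1}qE {1}/hinv /= (nth_map 0) ?size_iota // nth_iota //.
rewrite add0n kl -/(Q l) kr (nth_map 0) ?size_iota // nth_iota // add0n.
rewrite -surjective_pairing; by case: eqP.
Qed.

Lemma contraction_dec : contraction p q (dec m).
Proof.
split.
- by move=> k kq; rewrite cp // -nq.
- case=> l i /= /andP[/= lp il]; have [h1 h2 E] := legE lp il.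
  split; first by rewrite (E : (_, _) = _) lift_he.
  by have /andP[h3 _] := h2; have [_ kl _] := rankn lp h3.
- case=> l i [l' i'] /andP[/= lp il] /andP[/= lp' il'].
  have [h1 h2 E] := legE lp il; have [h1' h2' E'] := legE lp' il'.
  move=> LE0; have {LE0}LE : lift l (leg l i) = lift l' (leg l' i') := LE0.
  have ll : l = l'.
    have /andP[h3 _] := h2; have [_ <- _] := rankn lp h3.
    have /andP[h3' _] := h2'; have [_ <- _] := rankn lp' h3'.
    by case: LE => ->.
  subst l'; congr (_, _); have := lift_inj lp h2 h2' LE.
  move/eqP; rewrite nth_uniq ?lQ //; first by move/eqP.
  by have := valid_uniq_leaves (vQ lp).
- case=> l i /andP[/= lp il] eN; have [h1 h2 E] := legE lp il.
  rewrite -[LHS]/(hinv q (lift l (leg l i))) -[RHS]/((dec m).2 (hinv p (l, i))).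
  rewrite hinv_lift // h1 /leg index_uniq ?lQ //; last by have := valid_uniq_leaves (vQ lp).
  by rewrite /= eN.
- by rewrite qE.
- move=> h /heqP[l [h' [lp hh' -> _]]] N.
  have hl : h' \notin rleaves (Q l).
    apply/negP => hl; have il : index h' (rleaves (Q l)) < deg p l by rewrite -lQ // index_mem.
    have := N (l, index h' (rleaves (Q l))); rewrite /is_he lp => /(_ il) /eqP; apply.
    by have [_ _ ->] := legE lp il; rewrite /leg nth_index.
  rewrite hinv_lift // (negbTE hl) /=.
  have [/andP[h1 _] _] := valid_hinv (vQ lp) hh'; have /andP[h2 _] := hh'.
  by have [_ -> _] := rankn lp h1; have [_ -> _] := rankn lp h2.
Qed.

(** Cutting along the decoded map returns the graphs that were substituted, so every morphism is an
    [enc], and the parts inherit validity and the genus equation. *)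
Lemma part_dec l : l < nverts p -> part p q (dec m) l = Q l.
Proof.
move=> lp; have vQl := vQ lp; rewrite /part nq -/(F l).
have FQ j : j < size (F l) -> j < nverts (Q l) by rewrite nF.
apply: eq_rgraph.
- exact: size_rinv_sub.
- exact: valid_size_rinv.
- exact: size_rgen_sub.
- exact: valid_size_rgen.
- exact: size_rinv_nth_sub.
- exact: valid_size_rinv_nth.
- by rewrite nverts_sub nF.
- move=> j; rewrite nverts_sub => jl.
  by rewrite -{1}(index_uniq 0 jl (uF l)) deg_sub ?mem_nth // degF ?FQ.
- move=> h /(is_he_subP (uF l))[k [i [kF id ->]]]; rewrite hinv_sub //.
  have jF : index k (F l) < nverts (Q l) by rewrite nF ?index_mem.
  have kE : k = nth 0 (F l) (index k (F l)) by rewrite nth_index.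
  have hh : is_he (Q l) (index k (F l), i) by rewrite /is_he jF /= -degF // -kE.
  have lE : (k, i) = lift l (index k (F l), i) by rewrite /lift /= -kE.
  have -> : ((k, i) \in legs p (dec m).2 l) = ((index k (F l), i) \in rleaves (Q l)).
    apply/idP/idP => [/(legsP lp)[[l' s] [/andP[/= _ sd] /= E1 E2]]|hl].
      subst l'; have [h1 h2 _] := legE lp sd.
      have E3 : lift l (index k (F l), i) = lift l (leg l s) by rewrite -lE E2.
      by rewrite (lift_inj lp hh h2 E3).
    have il : index (index k (F l), i) (rleaves (Q l)) < deg p l by rewrite -lQ // index_mem.
    have [_ _ E] := legE lp il; rewrite /leg nth_index // -lE in E; rewrite -E.
    by apply: mem_legs; rewrite // /is_he lp.
  rewrite -(valid_leafE vQl hh); case: eqP => // /eqP hN.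
  rewrite lE hinv_lift // -(valid_leafE vQl hh) (negbTE hN) /=.
  have [/andP[h1 _] _] := valid_hinv vQl hh.
  by rewrite index_uniq -?nF // -surjective_pairing.
- rewrite /= /legs -map_comp; apply: (@eq_from_nth _ (0,0)); first by rewrite size_map size_iota lQ.
  move=> i; rewrite size_map size_iota => il; rewrite (nth_map 0) ?size_iota // nth_iota // add0n.
  have [h1 /andP[h2 _] _] := legE lp il.
  rewrite -[LHS]/(index (nth 0 (F l) (leg l i).1) (F l), (leg l i).2).
  by rewrite index_uniq -?nF // -surjective_pairing.
- move=> j; rewrite nverts_sub => jl.
  by rewrite -{1}(index_uniq 0 jl (uF l)) rgen_sub ?mem_nth // genF ?FQ.
Qed.

Lemma dec_parts l : l < nverts p -> valid (part p q (dec m) l) /\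
  nth 0 (rgen p) l = sumn (rgen (part p q (dec m) l)) + genus (part p q (dec m) l).
Proof. by move=> lp; rewrite part_dec //; split; [exact: vQ | exact: gQ]. Qed.

Lemma enc_dec : enc p q (dec m) = m.
Proof.
transitivity (RM (mparts m) (mcol m)); last by case: (m).
rewrite /enc; congr RM; last by rewrite nq /= -cE.
apply: (@eq_from_nth _ rg0); rewrite size_map size_iota ?sQ // => l lp.
by rewrite (nth_map 0) ?size_iota // nth_iota // add0n -/(part p q (dec m) l) part_dec.
Qed.
End Dec.

Lemma enc_id p : enc p p (id, id) = rid p.
Proof.
rewrite /enc /rid map_id; congr RM; apply/eq_in_map => v; rewrite mem_iota /= add0n => vn.
have -> : fibre (nverts p) id v = [:: v].
  apply/perm_small_eq => //; apply: uniq_perm; rewrite ?uniq_fibre // => k.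
  by rewrite mem_fibre inE; case: eqP => // ->; rewrite vn.
rewrite /legs /sub /corolla /=; congr RG; rewrite -?map_comp.
- congr [:: _]; apply/eq_in_map => i il; by rewrite map_f ?eqxx //= eqxx.
- by apply/eq_map => i /=; rewrite eqxx.
Qed.

(** * Kruskal's theorem for labelled plane forests *)

Definition good (T : Type) (R : T -> T -> Prop) (s : nat -> T) := exists i j, i < j /\ R (s i) (s j).

Definition smono (g : nat -> nat) := forall i j, i < j -> g i < g j.

Lemma smono_step g : (forall n, g n < g n.+1) -> smono g.
Proof.
move=> H i; elim=> // j IH; rewrite ltnS leq_eqVlt => /orP[/eqP ->|/IH lt] //.
exact: ltn_trans (H j).
Qed.

Section Chain.
Variables (T : Type) (R : T -> T -> Prop) (P : T -> Prop).
Hypothesis Rtr : forall x y z, R x y -> R y z -> R x z.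
Hypothesis wq : forall s, (forall k, P (s k)) -> good R s.

(** If infinitely many terms had no larger later term, they would form a bad sequence; past the last
    such term one can always step upwards, and transitivity does the rest. The predicate [P] allows
    a relation known to be good only on part of [T]. *)
Lemma increasing_subsequence s : (forall k, P (s k)) ->
  exists2 g, smono g & forall i j, i < j -> R (s (g i)) (s (g j)).
Proof.
move=> Ps; pose term i := ~ exists2 j, i < j & R (s i) (s j).
have [N HN] : exists N, forall i, N <= i -> ~ term i.
  apply: NNPP => H.
  have {}H N : exists i, N <= i /\ term i.
    apply: NNPP => H'; apply: H; exists N => i Ni ti; apply: H'; by exists i.
  pose nx N := proj1_sig (constructive_indefinite_description _ (H N)).
  have nxP N : N <= nx N /\ term (nx N) := proj2_sig (constructive_indefinite_description _ (H N)).
  pose h := fix h n := if n is n'.+1 then nx (h n').+1 else nx 0.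
  have hm : smono h by apply: smono_step => n /=; have [] := nxP (h n).+1.
  have [i [j [ij Rij]]] := wq (fun k => Ps (h k)).
  have ht : term (h i) by case: (i) => [|n] /=; apply: (nxP _).2.
  by apply: ht; exists (h j) => //; apply: hm.
(* The condition on [i] moves inside the existential so that the choice of [j] is a total
   function. *)
have {}HN i : exists j, N <= i -> i < j /\ R (s i) (s j).
  case: (leqP N i) => [/HN H|_]; last by exists 0.
  by have [j ij Rij] := NNPP _ H; exists j.
pose nx i := proj1_sig (constructive_indefinite_description _ (HN i)).
have nxP i : N <= i -> i < nx i /\ R (s i) (s (nx i)) := proj2_sig (constructive_indefinite_description _ (HN i)).
pose g n := iter n nx N.
have gN n : N <= g n.
  by elim: n => //= n IH; apply: leq_trans (IH) (ltnW (nxP _ IH).1).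
exists g; first by apply: smono_step => n /=; case: (nxP _ (gN n)).
move=> i; elim=> // j IH; rewrite ltnS leq_eqVlt => /orP[/eqP ->|/IH].
  by case: (nxP _ (gN j)).
by move/Rtr; apply; case: (nxP _ (gN j)).
Qed.
End Chain.

Lemma finite_good (L : finType) (s : nat -> L) : good (@eq L) s.
Proof.
apply: NNPP => H; have : injective (fun i : 'I_(#|L|.+1) => s i).
  move=> i j E; apply/val_inj; case: (ltngtP (val i) (val j)) => // lt; case: H.
    by exists i, j.
  by exists j, i.
by move/leq_card; rewrite card_ord ltnn.
Qed.

Section MinimalBad.
Variables (T : Type) (R : T -> T -> Prop) (size : T -> nat) (x0 : T).

(** Nash-Williams' minimal bad sequence. [U n.+1] keeps the first [n] terms of [U n] and makes term
    [n] as small as a bad sequence with this beginning permits; the diagonal inherits badness and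
    minimality. *)
Lemma minimal_bad s0 : ~ good R s0 ->
  exists s, ~ good R s /\ forall n s', ~ good R s' -> (forall i, i < n -> s' i = s i) -> size (s n) <= size (s' n).
Proof.
move=> bs0.
pose ext n (u : nat -> T) (s : nat -> T) := ~ good R s /\ forall i, i < n -> s i = u i.
have step n u : exists v, (exists s, ext n u s) ->
    ext n u v /\ forall s, ext n u s -> size (v n) <= size (s n).
  case: (classic (exists s, ext n u s)) => [[s hs]|H]; last by exists u.
  have [m] := ubnP (size (s n)); elim: m s hs => // m IH s hs sm.
  case: (classic (exists2 s', ext n u s' & size (s' n) < size (s n))) => [[s' hs' lt]|H].
    by apply: IH hs' _; lia.
  exists s => _; split=> // s' hs'; rewrite leqNgt; apply/negP => lt.
  by apply: H; exists s'.
pose nx n u := proj1_sig (constructive_indefinite_description _ (step n u)).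
have nxP n u : (exists s, ext n u s) -> ext n u (nx n u) /\ forall s, ext n u s -> size (nx n u n) <= size (s n)
  := proj2_sig (constructive_indefinite_description _ (step n u)).
pose U := fix U n := if n is n'.+1 then nx n' (U n') else s0.
have UB n : ~ good R (U n).
  elim: n => // n IH /=; have [|[]//] := nxP n (U n) _.
  by exists (U n).
have Uext n : exists s, ext n (U n) s by exists (U n); split.
have US n i : i < n -> U n.+1 i = U n i.
  by move=> lt /=; have [[_ H] _] := nxP n (U n) (Uext n); apply: H.
have UL n k i : i < n -> U (n + k) i = U n i.
  by move=> lt; elim: k => [|k IH]; rewrite ?addn0 // addnS US ?IH // ltn_addr.
have UD n i : i < n -> U n i = U i.+1 i.
  by move=> lt; rewrite -(subnKC lt) UL.
exists (fun n => U n.+1 n); split=> [[i [j [ij Rij]]]|n s' bs' H].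
  apply: (UB j.+1); exists i, j; split=> //.
  by rewrite (UD j.+1 i) //; apply: ltnW.
have [_] := nxP n (U n) (Uext n); apply; split=> // i lt.
by rewrite H // -(UD n).
Qed.
End MinimalBad.

(* Plane forests in first-child/next-sibling encoding: [FCons a c r] is the tree
   with root [a] and children [c], followed by the trees of [r]. *)
Inductive forest (A : Type) := FNil | FCons of A & forest A & forest A.
Arguments FNil {A}.

Fixpoint fsize A (f : forest A) := if f is FCons _ c r then (fsize c + fsize r).+1 else 0.
Fixpoint fmap A B (h : A -> B) (f : forest A) :=
  if f is FCons a c r then FCons (h a) (fmap h c) (fmap h r) else FNil.

(** With first child and next sibling as left and right subtree, this is the homeomorphic embedding
    of binary trees. Kruskal's theorem for it needs only pairs of subforests, not Higman's lemma on
    sequences. *)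
Fixpoint femb A B (R : A -> B -> Prop) (f : forest A) (g : forest B) : Prop :=
  match g with
  | FNil => f = FNil
  | FCons b d s => [\/ f = FNil, femb R f d, femb R f s |
      if f is FCons a c r then [/\ R a b, femb R c d & femb R r s] else False]
  end.

Lemma femb_nil A B (R : A -> B -> Prop) g : femb R FNil g.
Proof. by case: g => //= *; constructor. Qed.

Lemma femb_fmap A B L (h : A -> L) (k : B -> L) f g :
  femb eq (fmap h f) (fmap k g) -> femb (fun a b => h a = k b) f g.
Proof.
elim: g f => [|b d IHd s IHs] f /=; first by case: f.
case=> [f0|fd|fs|].
- by constructor 1; case: f f0.
- by constructor 2; apply: IHd.
- by constructor 3; apply: IHs.
- by case: f => // a c r /= [ab cd rs]; constructor 4; split=> //; [apply: IHd | apply: IHs].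
Qed.

Lemma femb_trans A (f g h : forest A) : femb eq f g -> femb eq g h -> femb eq f h.
Proof.
elim: h f g => [|b d IHd s IHs] f g; first by move=> /[swap] /= ->.
move=> fg /= [g0|gd|gs|].
- by constructor 1; rewrite g0 in fg.
- by constructor 2; apply: IHd gd.
- by constructor 3; apply: IHs gs.
- case: g fg => // b' d' s' /= fg [bb dd ss]; subst b'; case: fg => [|fd|fs|].
  + by constructor 1.
  + by constructor 2; apply: IHd dd.
  + by constructor 3; apply: IHs ss.
  + case: f => // a c r [-> cd rs]; constructor 4; split=> //; first exact: IHd dd.
    exact: IHs ss.
Qed.

(** The immediate subforests of a minimal bad sequence are well-quasi-ordered ([sub]). Passing to
    subsequences with constant root label and increasing children leaves a good pair among the
    sibling parts. *)
Theorem kruskal (L : finType) (s : nat -> forest L) : good (femb eq) s.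
Proof.
apply: NNPP => /(minimal_bad (@fsize L))[{}s [bs min]].
have sC n : exists x, s n = FCons x.1.1 x.1.2 x.2.
  case E : (s n) => [|a c r]; last by exists (a, c, r).
  by case: bs; exists n, n.+1; split=> //; rewrite E; apply: femb_nil.
pose x n := proj1_sig (constructive_indefinite_description _ (sC n)).
have xE n : s n = FCons (x n).1.1 (x n).1.2 (x n).2 := proj2_sig (constructive_indefinite_description _ (sC n)).
pose below u n := (u = (x n).1.2 \/ u = (x n).2).
have belowS u n : below u n -> fsize u < fsize (s n).
  by rewrite xE /= => -[] ->; lia.
have belowE u n f : below u n -> femb eq f u -> femb eq f (s n).
  by rewrite xE /= => -[] -> ?; [constructor 2 | constructor 3].
have sub u : (forall k, exists n, below (u k) n) -> good (femb eq) u.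
  move=> Hu; apply: NNPP => bu.
  pose ix k := proj1_sig (constructive_indefinite_description _ (Hu k)).
  have ixP k : below (u k) (ix k) := proj2_sig (constructive_indefinite_description _ (Hu k)).
  (* [k0] minimises the origin, so everything spliced in at position [n] comes from a term of index
     at least [n]. The spliced sequence stays bad and undercuts the minimal one at [n]. *)
  have [k0 mk0] : exists k0, forall k, ix k0 <= ix k.
    have [m] := ubnP (ix 0); elim: m 0 => // m IH k km.
    case: (classic (exists k', ix k' < ix k)) => [[k' lt]|H]; first by apply: (IH k'); lia.
    by exists k => k'; rewrite leqNgt; apply/negP => lt; apply: H; exists k'.
  pose n := ix k0; pose s' i := if i < n then s i else u (k0 + (i - n)).
  have bs' : ~ good (femb eq) s'.
    case=> i [j [ij]]; rewrite /s'; case: (ltnP i n) => lin; case: (ltnP j n) => ljn.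
    - by move=> E; apply: bs; exists i, j.
    - move=> E; apply: bs; exists i, (ix (k0 + (j - n))); split; last exact: belowE E.
      exact: leq_trans lin (mk0 _).
    - by lia.
    - by move=> E; apply: bu; exists (k0 + (i - n)), (k0 + (j - n)); split=> //; lia.
  have := min n s' bs' _; rewrite {2}/s' ltnn subnn addn0 => H.
  have := belowS _ _ (ixP k0); rewrite ltnNge H // => i lt.
  by rewrite /s' lt.
have tr := @femb_trans L.
have [g1 m1 e1] := @increasing_subsequence _ eq (fun=> True) (fun a b c => @etrans _ a b c)
   (fun s _ => finite_good s) (fun n => (x n).1.1) (fun=> I).
have [|g2 m2 e2] := @increasing_subsequence _ _ (fun u => exists n, below u n) tr sub (fun n => (x (g1 n)).1.2).
  by move=> k; exists (g1 k); left.
have [|i [j [ij e3]]] := sub (fun n => (x (g1 (g2 n))).2).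
  by move=> k; exists (g1 (g2 k)); right.
apply: bs; exists (g1 (g2 i)), (g1 (g2 j)); split; first exact/m1/m2.
rewrite !xE /=; constructor 4; split=> //; first exact/e1/m2.
exact: e2.
Qed.

(** * Embeddings of forests *)

Section Forest.
Variable A : eqType.
Implicit Types (f g : forest A) (p : A).

Fixpoint pre f : seq A := if f is FCons a c r then a :: pre c ++ pre r else [::].

(** Edges as pairs of parent and child, where [p] is a virtual parent of the roots. *)
Fixpoint nodes p f : seq (A * A) :=
  if f is FCons a c r then (p, a) :: nodes a c ++ nodes p r else [::].

Lemma nodes2 p f : map snd (nodes p f) = pre f.
Proof. by elim: f p => //= a c IHc r IHr p; rewrite map_cat IHc IHr. Qed.

Lemma nodes_pre p f w y : (w, y) \in nodes p f -> y \in pre f.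
Proof. by move=> H; rewrite -(nodes2 p); apply: (map_f snd H). Qed.

Lemma pre_nodes p f y : y \in pre f -> exists w, (w, y) \in nodes p f.
Proof. by rewrite -(nodes2 p) => /mapP[[w z] H ->]; exists w. Qed.

(** Preorder puts parents before children, which makes it a measure for inductions towards the
    root. *)
Lemma nodes_index p f w y : uniq (p :: pre f) -> (w, y) \in nodes p f ->
  index w (p :: pre f) < index y (p :: pre f).
Proof.
elim: f p => //= a c IHc r IHr p; rewrite !inE !mem_cat !negb_or cat_uniq.
case/and3P => /and3P[pa pc pr] /andP[ac ar] /and3P[uc cr ur].
case/predU1P => [[-> ->]|/orP[] H]; first by rewrite eqxx (negbTE pa).
  have yc := nodes_pre H; have ac' : a != y by apply: contraNneq ac => ->.
  have := IHc a; rewrite /= ac uc => /(_ isT H) /=.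
  have pc' : p != y by apply: contraNneq pc => ->.
  rewrite (negbTE ac') (negbTE pc') [index y (_ ++ _)]index_cat yc [index w (_ ++ _)]index_cat.
  case: (p == w) => //; case: (a == w) => //.
  rewrite ltnS => lt; rewrite ifT //; rewrite -index_mem; apply: ltn_trans lt _.
  by rewrite index_mem.
have yr := nodes_pre H.
have := IHr p; rewrite /= pr ur => /(_ isT H) /=.
have pc' : p != y by apply: contraNneq pr => ->.
have ac' : a != y by apply: contraNneq ar => ->.
have yc : y \notin pre c by apply: contra cr => yc; apply/hasP; exists y.
rewrite (negbTE ac') (negbTE pc') [index y (_ ++ _)]index_cat (negbTE yc).
case: (p == w) => //; case: (a == w) => //; rewrite index_cat ltnS => lt.
have wr : w \in pre r by rewrite -index_mem; apply: ltn_trans lt _; rewrite index_mem.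
have wc : w \notin pre c by apply: contra cr => wc; apply/hasP; exists w.
by rewrite (negbTE wc) !ltnS ltn_add2l.
Qed.

Lemma nodes1 p f w y : (w, y) \in nodes p f -> w \in p :: pre f.
Proof.
elim: f p => //= a c IHc r IHr p; rewrite !inE => /predU1P[[-> _]|]; first by rewrite eqxx.
rewrite !mem_cat => /orP[/IHc|/IHr]; rewrite inE => /orP[] ->; rewrite ?orbT //.
Qed.

(** The vertex [y] becomes a childless first child of [x]. *)
Fixpoint insert x y f :=
  if f is FCons a c r then
    if a == x then FCons a (FCons y FNil c) r else FCons a (insert x y c) (insert x y r)
  else FNil.

Lemma insert_notin x y f : x \notin pre f -> insert x y f = f.
Proof.
elim: f => //= a c IHc r IHr; rewrite inE mem_cat !negb_or eq_sym.
by case/and3P=> /negbTE -> /IHc -> /IHr ->.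
Qed.

Lemma perm_insert x y f : uniq (pre f) -> x \in pre f -> perm_eq (pre (insert x y f)) (y :: pre f).
Proof.
elim: f => //= a c IHc r IHr; rewrite inE mem_cat cat_uniq => /and4P[_ uc /hasPn cr ur].
have [<- _|ax] := eqVneq x a.
  by apply/permP => P /=; rewrite addnCA.
rewrite mem_cat /= => /orP[xc|xr].
  have xr : x \notin pre r by apply/negP => /cr /negP; apply.
  apply/permP => P; have /permP/(_ P) /= E := IHc uc xc.
  by rewrite (insert_notin _ xr) /= !count_cat E -addnA addnCA.
have xc : x \notin pre c by exact: cr.
apply/permP => P; have /permP/(_ P) /= E := IHr ur xr.
by rewrite (insert_notin _ xc) /= !count_cat E [_ + (P y + _)]addnCA addnCA.
Qed.

Lemma nodes_insert x y p f w z : (w, z) \in nodes p (insert x y f) ->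
  (w, z) = (x, y) \/ (w, z) \in nodes p f.
Proof.
elim: f p => [|a c IHc r IHr] p /=; first by right.
case: eqP => [->|_] /=; rewrite !inE !mem_cat.
  by case/or4P=> [->|/eqP ->|->|->]; rewrite ?orbT; [right | left | right | right].
by case/or3P => [->|/IHc[->|->]|/IHr[->|->]]; rewrite ?orbT; [right | left | right | left | right].
Qed.
End Forest.

Section Embedding.
Variables (A B : eqType) (R : A -> B -> Prop).

(** [pi] projects back along [phi], and [emb_nodes] describes it on every edge of the target, [p]
    and [p'] being virtual parents of the roots. In its first case the parent of [phi x] need not be
    an image, but it projects to the parent of [x]. *)
Record embedding (p : A) (f : forest A) (p' : B) (g : forest B) (phi : A -> B) (pi : B -> A) : Prop :=
  Embedding {
    emb_root : pi p' = p;
    emb_subseq : subseq (map phi (pre f)) (pre g);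
    emb_R : forall x, x \in pre f -> R x (phi x);
    emb_K : forall x, x \in pre f -> pi (phi x) = x;
    emb_nodes : forall w y, (w, y) \in nodes p' g ->
      (exists2 x, (pi w, x) \in nodes p f & y = phi x) \/
      (y \notin map phi (pre f) /\ pi y = pi w) }.

Lemma sub_notin (s t : seq B) y : subseq s t -> y \notin t -> y \notin s.
Proof. by move=> /mem_subseq st; apply: contra => /st. Qed.

(* [pi y] is the lowest ancestor of [y] in the image of [phi], or [p] if there is none. *)
Lemma femb_embedding (b0 : B) f g p p' : femb R f g -> uniq (pre f) -> uniq (pre g) ->
  p \notin pre f -> p' \notin pre g ->
  exists phi pi, embedding p f p' g phi pi.
Proof.
elim: g f p p' => [|b d IHd s IHs] f p p'.
  by move=> -> *; exists (fun=> b0), (fun=> p); split.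
move=> fe uf /=; rewrite cat_uniq mem_cat inE !negb_or.
case/and4P => /andP[bd bs] ud /hasPn ds us pf /andP[pb]; rewrite mem_cat negb_or => /andP[pd ps].
have sd z : z \in pre d -> z \notin pre s by move=> zd; apply/negP => /ds /negP; apply.
have sd' z : z \in pre s -> z \notin pre d by exact: ds.
case: fe => [->|fd|fs|].
- exists (fun=> b0), (fun=> p); split=> //= *; by right.
(* All of [f] goes below [b]; [b] itself and the trees after it project to the virtual parent
   [p]. *)
- have [phi [pi [E1 E2 E3 E4 E5]]] := IHd f p b fd uf ud pf bd.
  exists phi, (fun y => if y \in pre d then pi y else p); split=> //.
  + by rewrite (negbTE pd).
  + by apply: subseq_trans E2 _; rewrite (subseq_trans (prefix_subseq _ (pre s))) ?subseq_cons.
  + by move=> x xf; rewrite (mem_subseq E2) ?map_f // E4.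
  + move=> w y; rewrite inE mem_cat => /predU1P[[-> ->]|/orP[H|H]].
    * by right; rewrite (negbTE pd) (negbTE bd); split=> //; apply: sub_notin E2 bd.
    * rewrite (nodes_pre H); have -> : (if w \in pre d then pi w else p) = pi w.
        by have := nodes1 H; rewrite inE => /predU1P[->|->] //; rewrite (negbTE bd) E1.
      exact: E5.
    * right; have ys := nodes_pre H; rewrite (negbTE (sd' _ ys)); split.
        exact: sub_notin E2 (sd' _ ys).
      by have := nodes1 H; rewrite inE => /predU1P[->|/sd' /negbTE -> //]; rewrite (negbTE pd).
- have [phi [pi [E1 E2 E3 E4 E5]]] := IHs f p p' fs uf us pf ps.
  exists phi, (fun y => if y \in pre s then pi y else p); split=> //.
  + by rewrite (negbTE ps).
  + by apply: subseq_trans E2 _; rewrite (subseq_trans (suffix_subseq (pre d) _)) ?subseq_cons.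
  + by move=> x xf; rewrite (mem_subseq E2) ?map_f // E4.
  + move=> w y; rewrite inE mem_cat => /predU1P[[-> ->]|/orP[H|H]].
    * by right; rewrite (negbTE ps) (negbTE bs); split=> //; apply: sub_notin E2 bs.
    * right; have yd := nodes_pre H; rewrite (negbTE (sd _ yd)); split.
        exact: sub_notin E2 (sd _ yd).
      have := nodes1 H; rewrite inE => /predU1P[->|/sd /negbTE -> //].
      by rewrite (negbTE bs).
    * rewrite (nodes_pre H); have -> : (if w \in pre s then pi w else p) = pi w.
        by have := nodes1 H; rewrite inE => /predU1P[->|->] //; rewrite (negbTE ps) E1.
      exact: E5.
- case: f uf pf => // a c r /=; rewrite cat_uniq mem_cat inE !negb_or.
  case/and4P => /andP[ac ar] uc /hasPn cr ur /andP[pa]; rewrite mem_cat negb_or => /andP[pc pr] [Rab fc fr].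
  have cr1 z : z \in pre c -> z \notin pre r by move=> zd; apply/negP => /cr /negP; apply.
  have cr2 z : z \in pre r -> z \notin pre c by exact: cr.
  have [ph1 [pi1 [C1 C2 C3 C4 C5]]] := IHd c a b fc uc ud ac bd.
  have [ph2 [pi2 [S1 S2 S3 S4 S5]]] := IHs r p p' fr ur us pr ps.
  pose phi x := if x == a then b else if x \in pre c then ph1 x else ph2 x.
  pose pi y := if y == b then a else if y \in pre d then pi1 y else pi2 y.
  have phc x : x \in pre c -> phi x = ph1 x.
    by move=> xc; rewrite /phi ifN ?xc //; apply: contraNneq ac => <-.
  have phr x : x \in pre r -> phi x = ph2 x.
    by move=> xr; rewrite /phi ifN ?ifN ?cr2 //; apply: contraNneq ar => <-.
  have pid y : y \in pre d -> pi y = pi1 y.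
    by move=> xc; rewrite /pi ifN ?xc //; apply: contraNneq bd => <-.
  have pis y : y \in pre s -> pi y = pi2 y.
    by move=> xr; rewrite /pi ifN ?ifN ?sd' //; apply: contraNneq bs => <-.
  have pha : phi a = b by rewrite /phi eqxx.
  have pib : pi b = a by rewrite /pi eqxx.
  have mc : map phi (pre c) = map ph1 (pre c) by apply/eq_in_map.
  have mr : map phi (pre r) = map ph2 (pre r) by apply/eq_in_map.
  have c1 x : x \in pre c -> ph1 x \in pre d by move=> xc; rewrite (mem_subseq C2) ?map_f.
  have r1 x : x \in pre r -> ph2 x \in pre s by move=> xc; rewrite (mem_subseq S2) ?map_f.
  have pp : pi p' = p by rewrite /pi (negbTE pb) (negbTE pd).
  exists phi, pi; split=> //=.
  + by rewrite pha eqxx map_cat mc mr cat_subseq.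
  + move=> x; rewrite inE mem_cat => /or3P[/eqP ->|xc|xr]; first by rewrite pha.
      by rewrite phc //; apply: C3.
    by rewrite phr //; apply: S3.
  + move=> x; rewrite inE mem_cat => /or3P[/eqP ->|xc|xr]; first by rewrite pha.
      by rewrite phc // pid ?C4 ?c1.
    by rewrite phr // pis ?S4 ?r1.
  + move=> w y; rewrite [_ \in (p', b) :: _]inE [_ \in _ ++ _]mem_cat => /predU1P[[-> ->]|/orP[H|H]].
    * by left; exists a; rewrite ?pha // pp inE eqxx.
    * have yd := nodes_pre H; have -> : pi w = pi1 w.
        by have := nodes1 H; rewrite inE => /predU1P[->|/pid //]; rewrite pib C1.
      case: (C5 _ _ H) => [[x xc ->]|[yN E]].
        left; exists x; first by rewrite inE mem_cat xc orbT.
        by rewrite phc // (nodes_pre xc).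
      right; rewrite pid //; split=> //; rewrite inE map_cat mem_cat pha mc mr !negb_or yN.
      by rewrite (sub_notin S2 (sd _ yd)) !andbT; apply: contraNneq bd => <-.
    * have ys := nodes_pre H; have -> : pi w = pi2 w.
        by have := nodes1 H; rewrite inE => /predU1P[->|/pis //]; rewrite pp S1.
      case: (S5 _ _ H) => [[x xr ->]|[yN E]].
        left; exists x; first by rewrite inE mem_cat xr !orbT.
        by rewrite phr // (nodes_pre xr).
      right; rewrite pis //; split=> //; rewrite inE map_cat mem_cat pha mc mr !negb_or yN.
      by rewrite (sub_notin C2 (sd' _ ys)) !andbT; apply: contraNneq bs => <-.
Qed.
End Embedding.

(** * Graphs with a rooted plane spanning tree *)

(* [tup v] is the half-edge at [v] leading to its parent (junk at the root), and
   [text] orders the half-edges that are neither leaves nor in the tree. *)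
Record tgraph := TGraph {
  tgr : rgraph;
  troot : nat;
  tch : forest nat;
  tup : nat -> nat * nat;
  text : seq (nat * nat);
  tvalid : validb tgr;
  tvs_perm : perm_eq (troot :: pre tch) (iota 0 (nverts tgr));
  tup_nodes : forall w y, (w, y) \in nodes troot tch ->
    [/\ is_he tgr (tup y), (tup y).1 = y & (hinv tgr (tup y)).1 = w];
  thes_perm : perm_eq ((rleaves tgr ++ text) ++
      flatten [seq [:: tup v; hinv tgr (tup v)] | v <- pre tch]) (hes tgr) }.

Definition tvs c := troot c :: pre (tch c).
Definition tspec c := rleaves (tgr c) ++ text c.
Definition ttree c := flatten [seq [:: tup c v; hinv (tgr c) (tup c v)] | v <- pre (tch c)].
Definition ths c := tspec c ++ ttree c.
Definition vrk c v := index v (tvs c).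
Definition hrk c h := index h (ths c).

Section TGraph.
Variable c : tgraph.
Let q := tgr c.

Lemma tg_valid : valid q. Proof. exact/validP/tvalid. Qed.
Lemma uniq_tvs : uniq (tvs c). Proof. by rewrite (perm_uniq (tvs_perm c)) iota_uniq. Qed.
Lemma mem_tvs v : (v \in tvs c) = (v < nverts q).
Proof. by rewrite (perm_mem (tvs_perm c)) mem_iota. Qed.
Lemma size_tvs : size (tvs c) = nverts q.
Proof. by rewrite (perm_size (tvs_perm c)) size_iota. Qed.
Lemma uniq_ths : uniq (ths c). Proof. by rewrite (perm_uniq (thes_perm c)) uniq_hes. Qed.
Lemma mem_ths h : (h \in ths c) = is_he q h. Proof. by rewrite (perm_mem (thes_perm c)) mem_hes. Qed.
Lemma troot_lt : troot c < nverts q. Proof. by rewrite -mem_tvs inE eqxx. Qed.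
Lemma tch_lt v : v \in pre (tch c) -> v < nverts q.
Proof. by rewrite -mem_tvs inE orbC => ->. Qed.
Lemma vrk_root : vrk c (troot c) = 0. Proof. by rewrite /vrk /= eqxx. Qed.
Lemma vrk_gt0 v : v < nverts q -> (0 < vrk c v) = (v \in pre (tch c)).
Proof.
rewrite -mem_tvs inE /vrk /= [v == _]eq_sym; case: eqP => [<- _|_ /= ->] //.
by have /andP[/negbTE ->] := uniq_tvs.
Qed.
Lemma vrk_inj u v : u < nverts q -> v < nverts q -> vrk c u = vrk c v -> u = v.
Proof. by rewrite -!mem_tvs; exact: index_inj_in. Qed.
Lemma hrk_inj h h' : is_he q h -> is_he q h' -> hrk c h = hrk c h' -> h = h'.
Proof. by rewrite -!mem_ths; exact: index_inj_in. Qed.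

Lemma tupP v : v \in pre (tch c) ->
  [/\ is_he q (tup c v), (tup c v).1 = v, vrk c (hinv q (tup c v)).1 < vrk c v,
      hinv q (tup c v) != tup c v & is_he q (hinv q (tup c v))].
Proof.
move=> /(pre_nodes (troot c))[w H]; have [h1 h2 h3] := tup_nodes H.
have lt := nodes_index uniq_tvs H; rewrite -/(tvs c) -/(vrk c w) -/(vrk c v) -h3 in lt.
split=> //; last by have [] := valid_hinv tg_valid h1.
by apply: contraTneq lt => ->; rewrite h2 ltnn.
Qed.

Lemma mem_ttree h : h \in ttree c ->
  exists2 v, v \in pre (tch c) & h = tup c v \/ h = hinv q (tup c v).
Proof. by case/flatten_mapP => v vt; rewrite !inE => /orP[] /eqP ->; exists v; auto. Qed.
End TGraph.

Section HalfEdges.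
Variable c : tgraph.

(** Otherwise [v] and [w] would be parents of each other, against the preorder rank. *)
Lemma tup_neq_hinv v w : v \in pre (tch c) -> w \in pre (tch c) ->
  tup c v != hinv (tgr c) (tup c w).
Proof.
move=> vc wc; apply/negP => /eqP E.
have [v1 v2 v3 v4 v5] := tupP vc; have [w1 w2 w3 w4 w5] := tupP wc.
have wK := (valid_hinv (tg_valid c) w1).2.
by move: v3; rewrite E wK w2 -[v]v2 E ltnNge ltnW.
Qed.

Lemma mem_ttree_up v : v \in pre (tch c) -> tup c v \in ttree c.
Proof. by move=> vc; apply/flatten_mapP; exists v; rewrite // inE eqxx. Qed.
Lemma mem_ttree_dn v : v \in pre (tch c) -> hinv (tgr c) (tup c v) \in ttree c.
Proof. by move=> vc; apply/flatten_mapP; exists v; rewrite // !inE eqxx orbT. Qed.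
Lemma ttree_notin_spec h : h \in ttree c -> h \notin tspec c.
Proof.
move=> ht; apply/negP => hs; have := uniq_ths c; rewrite cat_uniq => /and3P[_ /hasPn/(_ h ht)].
by rewrite hs.
Qed.
Lemma uniq_tspec : uniq (tspec c).
Proof. by have := uniq_ths c; rewrite cat_uniq => /and3P[]. Qed.
Lemma tspec_he h : h \in tspec c -> is_he (tgr c) h.
Proof. by rewrite -mem_ths [_ \in ths c]mem_cat => ->. Qed.

Variant he_spec : nat * nat -> Prop :=
  | HeSpec i of i < size (tspec c) : he_spec (nth (0, 0) (tspec c) i)
  | HeUp v of v \in pre (tch c) : he_spec (tup c v)
  | HeDown v of v \in pre (tch c) : he_spec (hinv (tgr c) (tup c v)).

Lemma heP h : is_he (tgr c) h -> he_spec h.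
Proof.
rewrite -mem_ths mem_cat => /orP[hs|/mem_ttree[v vc [->|->]]]; [|exact: HeUp|exact: HeDown].
by rewrite -(nth_index (0,0) hs); apply: HeSpec; rewrite index_mem.
Qed.

(** The tree half-edges form a union of edges, so their complement is stable under the
    involution. *)
Lemma hinv_tspec h : h \in tspec c -> hinv (tgr c) h \in tspec c.
Proof.
move=> hs; have hh := tspec_he hs; have [hh' hK] := valid_hinv (tg_valid c) hh.
move: hh'; rewrite -mem_ths [_ \in ths c]mem_cat => /orP[//|/mem_ttree[v vc E]].
have /negP[] : h \notin tspec c.
  apply: ttree_notin_spec; rewrite -hK; case: E => ->; first exact: mem_ttree_dn.
  have [h1 _ _ _ _] := tupP vc; rewrite (valid_hinv (tg_valid c) h1).2.
  exact: mem_ttree_up.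
by [].
Qed.
End HalfEdges.

Lemma sum_fibre n n' (y : nat -> nat) (P : pred nat) (F : nat -> nat) :
  (forall k, k < n' -> y k < n) ->
  \sum_(k <- iota 0 n' | P (y k)) F k = \sum_(w <- iota 0 n | P w) \sum_(k <- fibre n' y w) F k.
Proof.
move=> yn; under [RHS]eq_bigr do rewrite big_filter.
rewrite (exchange_big_dep (fun k => P (y k))) /=; last by move=> w k Pw /eqP ->.
rewrite big_seq_cond [RHS]big_seq_cond; apply: eq_bigr => k /andP[].
rewrite mem_iota /= add0n => kn Pk.
rewrite big_mkcond (bigD1_seq (y k)) ?iota_uniq ?mem_iota ?yn //= Pk eqxx.
by rewrite big1_seq ?addn0 // => w /andP[/negbTE wy _]; rewrite [y k == w]eq_sym wy andbF.
Qed.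

(* The section [s] picks the topmost vertex of each fibre. *)
Record tmor (c c' : tgraph) (x : cmap) : Prop := TMor {
  tm_con : contraction (tgr c) (tgr c') x;
  tm_sec : exists s : nat -> nat, [/\ s (troot c) = troot c',
     forall v, v < nverts (tgr c) -> s v < nverts (tgr c') /\ x.1 (s v) = v,
     forall u v, u < nverts (tgr c) -> v < nverts (tgr c) -> vrk c u < vrk c v -> vrk c' (s u) < vrk c' (s v),
     forall v, v \in pre (tch c) -> tup c' (s v) = x.2 (tup c v) &
     forall w, w < nverts (tgr c') -> w != s (x.1 w) ->
       vrk c' (s (x.1 w)) < vrk c' w /\ forall e, is_he (tgr c) e -> x.2 e != tup c' w];
  tm_tree : forall h, is_he (tgr c') h -> (forall e, is_he (tgr c) e -> x.2 e != h) ->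
     exists2 w, w \in pre (tch c') & h = tup c' w \/ h = hinv (tgr c') (tup c' w);
  tm_gen : forall v, v < nverts (tgr c) ->
     nth 0 (rgen (tgr c)) v = \sum_(w <- fibre (nverts (tgr c')) x.1 v) nth 0 (rgen (tgr c')) w;
  tm_mono : forall h h', is_he (tgr c) h -> is_he (tgr c) h' -> hrk c h < hrk c h' ->
     hrk c' (x.2 h) < hrk c' (x.2 h') }.

Lemma tmor_id c : tmor c c (id, id).
Proof.
split=> //=.
- by split=> //= [|h hh /(_ h hh)]; rewrite ?map_id ?eqxx.
- by exists id; split=> // w _; rewrite eqxx.
- by move=> h hh /(_ h hh); rewrite eqxx.
- move=> v vn; rewrite big_filter big_mkcond /= (bigD1_seq v) ?mem_iota ?iota_uniq //= eqxx.
  by rewrite big1_seq ?addn0 // => w /andP[/negbTE ->].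
Qed.

Lemma tmor_comp c c' c'' x y : tmor c c' x -> tmor c' c'' y -> tmor c c'' (ccmp y x).
Proof.
move=> [X1 [s [S1 S2 S3 S4 S5]] X3 X4 X5] [Y1 [t [T1 T2 T3 T4 T5]] Y3 Y4 Y5].
have vc := tg_valid c; have vc' := tg_valid c'; have vc'' := tg_valid c''.
split=> /=.
- exact: contraction_comp X1 Y1.
- exists (t \o s); split=> /=.
  + by rewrite S1.
  + by move=> v /S2[/T2[t1 ->]].
  + by move=> u v un vn lt; apply: T3 (S3 _ _ un vn lt); [case: (S2 u un)|case: (S2 v vn)].
  + move=> v vt; have [sv _] := S2 _ (tch_lt vt); rewrite T4 ?S4 //.
    rewrite -vrk_gt0 // -(vrk_root c') -S1.
    by apply: S3; rewrite ?troot_lt ?tch_lt // vrk_root vrk_gt0 // tch_lt.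
  (* If [w] is not the top of its fibre under [y], the edge above it is contracted by [y]; if it is,
     that edge is the image of the edge above [y.1 w], which is contracted by [x]. *)
  + move=> w wn wN; have yn := con_f Y1 wn.
    have [E|E] := eqVneq w (t (y.1 w)); last first.
      have [lt N] := T5 w wn E; split; last by move=> e /(con_g X1)[/N].
      have [E'|/(S5 _ yn)[lt' _]] := eqVneq (y.1 w) (s (x.1 (y.1 w))); first by rewrite -E'.
      apply: ltn_trans lt; apply: T3 => //.
      by have [] := S2 _ (con_f X1 yn).
    have NE : y.1 w != s (x.1 (y.1 w)) by apply: contraNneq wN => <-; rewrite -E.
    have [lt N] := S5 _ yn NE; split.
      rewrite [X in _ < vrk c'' X]E; apply: T3 => //.
      by have [] := S2 _ (con_f X1 yn).
    have yt : y.1 w \in pre (tch c') by rewrite -vrk_gt0 // (leq_ltn_trans _ lt).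
    move=> e he; rewrite E T4 //; apply: contra (N _ he) => /eqP/(con_inj Y1) -> //.
      by have [] := con_g X1 he.
    by have [] := tupP yt.
- move=> h hh N; case: (boolP (has (fun e => y.2 e == h) (hes (tgr c')))) => [/hasP[e]|/hasPn N'].
    rewrite mem_hes => he /eqP E; rewrite -E.
    have Ne e' : is_he (tgr c) e' -> x.2 e' != e.
      by move=> he'; apply: contraNneq (N _ he') => ->; rewrite E.
    have [w wt H] := X3 e he Ne; have [u1 u2 u3 u4 u5] := tupP wt.
    have wn := tch_lt wt; have [tw yt] := T2 _ wn.
    exists (t w).
      rewrite -vrk_gt0 // -(vrk_root c'') -T1; apply: T3 => //; first exact: troot_lt.
      by rewrite vrk_root vrk_gt0.
    by rewrite T4 // (con_inv Y1) //; case: H => ->; [left | right].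
  by apply: Y3 => // e; rewrite -mem_hes; apply: N'.
- move=> v vn; rewrite X4 // /fibre [RHS]big_filter.
  rewrite (@sum_fibre (nverts (tgr c')) (nverts (tgr c'')) y.1 (fun k => x.1 k == v)); last exact: con_f Y1.
  rewrite big_filter big_seq_cond [RHS]big_seq_cond; apply: eq_bigr => w.
  by rewrite mem_iota /= add0n => /andP[wn _]; rewrite Y4.
- move=> h h' hh hh' lt; have [? _] := con_g X1 hh; have [? _] := con_g X1 hh'.
  by apply: Y5 => //; apply: X5.
Qed.

Section TMor.
Variables (c c' : tgraph) (x : cmap).
Hypothesis m : tmor c c' x.
Let p := tgr c. Let q := tgr c'.
Let vp := tg_valid c. Let vq := tg_valid c'.

(** Each fibre is a subtree: its vertices climb to the top vertex along uncut tree edges, which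
    gives connectedness, and the uncut half-edges lie in one pair for each other vertex. An upper
    bound on their number suffices, as [genus] is a truncated difference. *)
Lemma tmor_part v : v < nverts p -> valid (part p q x v) /\ genus (part p q x v) = 0.
Proof.
move=> vn; have [X1 [s [S1 S2 S3 S4 S5]] X3 _ _] := m.
set F := fibre (nverts q) x.1 v.
have FE k : (k \in F) = (x.1 k == v) && (k < nverts q) by exact: mem_fibre.
have uF : uniq F by exact: uniq_fibre.
have [sn xs] := S2 _ vn.
have sF : s v \in F by rewrite FE xs eqxx.
have nontop w : w \in F -> w != s v ->
  [/\ w \in pre (tch c'), tup c' w \notin legs p x.2 v, hinv q (tup c' w) \notin legs p x.2 v
    & (hinv q (tup c' w)).1 \in F].
  rewrite FE => /andP[/eqP xw wn] ws; rewrite -xw in ws; have [lt N] := S5 w wn ws.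
  have wt : w \in pre (tch c') by rewrite -vrk_gt0 // (leq_ltn_trans _ lt).
  have [u1 u2 u3 u4 u5] := tupP wt; have [h1 /andP[h2 _] h3] := con_out vp vq X1 u1 N.
  split=> //.
  - by apply/negP => /(legsP vn)[e [he _ E]]; have := N _ he; rewrite -E eqxx.
  - by apply/negP => /(legsP vn)[e [he _ E]]; have := h3 _ he; rewrite -E eqxx.
  - by rewrite FE h2 (con_fib X1 u1 N) u2 xw eqxx.
have nR : nverts (part p q x v) = size F by rewrite nverts_sub.
have adjR k i : k \in F -> i < deg q k -> (k, i) \notin legs p x.2 v ->
   forall a b : 'I_(nverts (part p q x v)), val a = index k F -> val b = index (hinv q (k, i)).1 F ->
   adj a b.
  move=> kF id N a b Ea Eb; apply/hasP; exists i; first by rewrite mem_iota Ea deg_sub.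
  by rewrite Ea hinv_sub // (negbTE N) Eb.
have conn : connectedb (part p q x v).
  have top (a : 'I_(nverts (part p q x v))) : forall b, val b = index (s v) F ->
      connect (@adj _) a b && connect (@adj _) b a.
    move=> b Eb; have aF : nth 0 F a \in F by rewrite mem_nth // -nR.
    have [k] := ubnP (vrk c' (nth 0 F a)); elim: k a aF => // k IH a aF lt.
    have Ea : val a = index (nth 0 F a) F by rewrite index_uniq // -nR.
    have [E|/(nontop _ aF)[wt N1 N2 uF']] := eqVneq (nth 0 F a) (s v).
      have -> : a = b by apply/val_inj; rewrite Ea E Eb.
      by rewrite connect0.
    have [u1 u2 u3 u4 u5] := tupP wt; set w := nth 0 F a in Ea wt N1 N2 uF' u1 u2 u3 u4 u5 lt aF *.
    have dn : index (hinv q (tup c' w)).1 F < nverts (part p q x v) by rewrite nR index_mem.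
    pose d := Ordinal dn.
    have Ed : nth 0 F d = (hinv q (tup c' w)).1 by rewrite nth_index.
    have /andP[db bd] : connect (@adj _) d b && connect (@adj _) b d.
      by apply: IH; rewrite Ed // (leq_trans u3).
    have upE : tup c' w = (w, (tup c' w).2) by rewrite -{2}u2 -surjective_pairing.
    have hE : hinv q (tup c' w) = ((hinv q (tup c' w)).1, (hinv q (tup c' w)).2).
      by rewrite -surjective_pairing.
    have ad : adj a d.
      apply: (@adjR w (tup c' w).2) => //; rewrite -?upE //.
      by have /andP[] := u1; rewrite u2.
    have da : adj d a.
      apply: (@adjR (hinv q (tup c' w)).1 (hinv q (tup c' w)).2) => //; rewrite -?hE //.
        by have /andP[] := u5.
      by rewrite (valid_hinv vq u1).2 u2.
    by rewrite (connect_trans (connect1 ad) db) (connect_trans bd (connect1 da)).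
  have tn : index (s v) F < nverts (part p q x v) by rewrite nR index_mem.
  apply/forallP => a; apply/forallP => b.
  have /andP[H _] := top a (Ordinal tn) erefl; have /andP[_ H'] := top b (Ordinal tn) erefl.
  exact: connect_trans H H'.
have F0 : 0 < size F by rewrite -has_predT; apply/hasP; exists (s v).
split; first exact: valid_part.
pose H := flatten [seq [seq (k, i) | i <- iota 0 (deg q k)] | k <- F].
have sH : size (hes (part p q x v)) = size H.
  by rewrite size_hes_sub // size_flatten /shape -map_comp sumnE big_map; apply: eq_bigr => j _; rewrite /= size_map size_iota.
have uH : uniq H.
  rewrite /H; elim: (F) uF => //= k F' IH /andP[kF' uF'].
  rewrite cat_uniq IH // andbT map_inj_uniq ?iota_uniq //=; last by move=> i j [].
  apply/hasPn => h /flatten_mapP[w ws /mapP[i _ ->]].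
  by apply: contra kF' => /mapP[j _ [<- _]].
(* An uncut half-edge belongs to the edge above a vertex of the fibre other than its top: the edge
   above the top is an image of [x.2], or absent at the root. *)
have sub : {subset H <= legs p x.2 v ++ flatten [seq [:: tup c' w; hinv q (tup c' w)] | w <- rem (s v) F]}.
  move=> h /flatten_mapP[k kF /mapP[i]]; rewrite mem_iota /= add0n => id hE; rewrite mem_cat.
  have [//|hN] := boolP (h \in legs p x.2 v); rewrite orFb.
  have [xk kn] : x.1 k = v /\ k < nverts q by move: kF; rewrite FE => /andP[/eqP].
  have hh : is_he q h by rewrite hE /is_he kn.
  have N e : is_he p e -> x.2 e != h.
    move=> he; apply: contra hN => /eqP E; rewrite -E; apply: mem_legs => //.
    by rewrite -(con_g X1 he).2 E hE.
  have [w wt H'] := X3 h hh N; have [u1 u2 u3 u4 u5] := tupP wt.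
  have N' e : is_he p e -> x.2 e != tup c' w.
    case: H' => E he; first by rewrite -E; exact: N.
    have [_ _ H3] := con_out vp vq X1 hh N; have := H3 _ he.
    by rewrite E (valid_hinv vq u1).2.
  have xw : x.1 w = v.
    have := con_fib X1 u1 N'; rewrite u2 => <-.
    by case: H' => E; [rewrite -E (con_fib X1 hh N) hE | rewrite -E hE].
  apply/flatten_mapP; exists w; last by rewrite !inE; case: H' => ->; rewrite eqxx ?orbT.
  rewrite mem_rem_uniq // !inE FE xw eqxx tch_lt // !andbT.
  apply/negP => /eqP ws; have vt : v \in pre (tch c).
    rewrite -vrk_gt0 //; case: (posnP (vrk c v)) => // v0.
    have vr : v = troot c by apply: (@vrk_inj c); rewrite ?troot_lt ?vrk_root ?v0.
    have := wt; rewrite ws vr S1 => rt; have := uniq_tvs c'; by rewrite /= rt.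
  have [e1 _ _ _ _] := tupP vt; have := N' _ e1; by rewrite -S4 // ws eqxx.
have := uniq_leq_size uH sub; rewrite size_cat /legs size_map size_iota -/p.
have -> : size (flatten [seq [:: tup c' w; hinv q (tup c' w)] | w <- rem (s v) F]) = (size F).-1.*2.
  by rewrite -(size_rem sF); elim: (rem _ _) => //= w l ->.
move: (size H) sH F0 => sH; rewrite /genus nR => -> F0.
rewrite /part /= !size_map size_iota; lia.
Qed.

Lemma tmor_parts v : v < nverts p -> valid (part p q x v) /\
  nth 0 (rgen p) v = sumn (rgen (part p q x v)) + genus (part p q x v).
Proof.
move=> vn; have [h ->] := tmor_part vn; split=> //.
by rewrite addn0 (tm_gen m) // sumnE big_map.
Qed.
End TMor.

(** * The category of graphs with a spanning tree *)

(** Morphisms are the encoded lists rather than the maps [x], which may differ outside the relevant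
    range. The category laws become equations between lists, and the functor is an inclusion on
    morphisms. *)
Definition tHom c c' := {m : rmor | exists2 x, tmor c c' x & m = enc (tgr c) (tgr c') x}.

Lemma tHom_eq c c' (f g : tHom c c') : sval f = sval g -> f = g.
Proof. by apply: eq_sig_hprop => m; apply: proof_irrelevance. Qed.

Lemma tHom_is_mor c c' (f : tHom c c') : is_mor (tgr c) (tgr c') (sval f).
Proof.
have [x m ->] := svalP f; apply: is_mor_enc (tm_con m) (tmor_parts m); exact: tg_valid.
Qed.

Lemma rcomp_tmor c c' c'' x y : tmor c c' x -> tmor c' c'' y ->
  rcomp (enc (tgr c) (tgr c') x) (enc (tgr c') (tgr c'') y) = enc (tgr c) (tgr c'') (ccmp y x).
Proof.
move=> X Y; apply: rcomp_enc (tm_con X) (tm_con Y) _ => [|||l /(tmor_parts X)[]//]; exact: tg_valid.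
Qed.

Lemma tid_proof c : exists2 x, tmor c c x & rid (tgr c) = enc (tgr c) (tgr c) x.
Proof. by exists (id, id); [exact: tmor_id | rewrite enc_id]. Qed.

Lemma tcomp_proof c c' c'' (g : tHom c' c'') (f : tHom c c') :
  exists2 x, tmor c c'' x & rcomp (sval f) (sval g) = enc (tgr c) (tgr c'') x.
Proof.
have [x X ->] := svalP f; have [y Y ->] := svalP g.
by exists (ccmp y x); [exact: tmor_comp X Y | exact: rcomp_tmor].
Qed.

Definition tid c : tHom c c := exist _ _ (tid_proof c).
Definition tcomp c c' c'' (g : tHom c' c'') (f : tHom c c') : tHom c c'' :=
  exist _ _ (tcomp_proof g f).

Lemma tcompA a b c d (h : tHom c d) (g : tHom b c) (f : tHom a b) :
  tcomp h (tcomp g f) = tcomp (tcomp h g) f.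
Proof.
apply: tHom_eq => /=; have [x X ->] := svalP f; have [y Y ->] := svalP g; have [z Z ->] := svalP h.
have XY := tmor_comp X Y; have YZ := tmor_comp Y Z.
by rewrite (rcomp_tmor X Y) (rcomp_tmor Y Z) (rcomp_tmor XY Z) (rcomp_tmor X YZ).
Qed.

Lemma tcomp1l a b (f : tHom a b) : tcomp (tid b) f = f.
Proof.
apply: tHom_eq => /=; have [x X ->] := svalP f.
by rewrite -enc_id (rcomp_tmor X (tmor_id b)).
Qed.

Lemma tcomp1r a b (f : tHom a b) : tcomp f (tid a) = f.
Proof.
apply: tHom_eq => /=; have [x X ->] := svalP f.
by rewrite -enc_id (rcomp_tmor (tmor_id a) X).
Qed.

Definition tCat : Category := Cat tcompA tcomp1l tcomp1r.

Definition tF0 (c : Ob tCat) : ograph := exist _ (tgr c) (tvalid c).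
Definition tF1 (c c' : Ob tCat) (f : Hom c c') : Dhom (tF0 c) (tF0 c') :=
  exist _ (sval f) (tHom_is_mor f).

(** * The admissible order *)

Definition lexlt (s t : seq nat) :=
  exists i, [/\ i < size s, nth 0 s i < nth 0 t i & forall j, j < i -> nth 0 s j = nth 0 t j].

Lemma lexlt_trans s t u : size s = size t -> lexlt s t -> lexlt t u -> lexlt s u.
Proof.
move=> st [i [si lt Hi]] [j [sj lt' Hj]].
case: (ltngtP i j) => ij.
- by exists i; rewrite -Hj //; split=> // k ki; rewrite Hi // Hj // (ltn_trans ki).
- by exists j; rewrite st Hi //; split=> // k ki; rewrite Hi ?Hj // (ltn_trans ki).
- by subst j; exists i; rewrite (ltn_trans lt lt'); split=> // k ki; rewrite Hi ?Hj.
Qed.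

Lemma lexlt_irr s : ~ lexlt s s.
Proof. by case=> i [_]; rewrite ltnn. Qed.

Lemma lexlt_total s t : size s = size t -> [\/ s = t, lexlt s t | lexlt t s].
Proof.
elim: s t => [|a s IH] [|b t] //=; first by constructor.
case=> /IH{}IH; case: (ltngtP a b) => ab.
- by constructor 2; exists 0.
- by constructor 3; exists 0.
- rewrite ab; case: IH => [->|[i [H1 H2 H3]]|[i [H1 H2 H3]]]; first by constructor.
    by constructor 2; exists i.+1; split=> // -[|j] //; apply: H3.
  by constructor 3; exists i.+1; split=> // -[|j] //; apply: H3.
Qed.

Lemma lexlt_cat s1 s2 t1 t2 : size s1 = size t1 -> lexlt (s1 ++ s2) (t1 ++ t2) <->
  lexlt s1 t1 \/ (s1 = t1 /\ lexlt s2 t2).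
Proof.
move=> st; split=> [[i [H1 H2 H3]]|[[i [H1 H2 H3]]|[-> [i [H1 H2 H3]]]]].
- move: H2; rewrite !nth_cat -st; have [si|si] := ltnP i (size s1) => H2.
    left; exists i; split=> // j ji; have := H3 j ji.
    by rewrite !nth_cat -st (ltn_trans ji si).
  right; split.
    apply: (@eq_from_nth _ 0) => // j js; have := H3 j (leq_trans js si).
    by rewrite !nth_cat -st js.
  exists (i - size s1); split=> //; first by rewrite size_cat in H1; lia.
  move=> j ji; have := H3 (size s1 + j); rewrite !nth_cat -st.
  have -> : (size s1 + j < size s1) = false by lia.
  by rewrite addKn; apply; lia.
- exists i; rewrite size_cat !nth_cat -st H1; split=> //; first by rewrite ltn_addr.
  by move=> j ji; rewrite !nth_cat -st (ltn_trans ji H1) H3.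
- exists (size t1 + i); have nlt : (size t1 + i < size t1) = false by lia.
  rewrite size_cat ltn_add2l !nth_cat nlt addKn; split=> // j ji.
  by rewrite !nth_cat; have [//|tj] := ltnP j (size t1); apply: H3; lia.
Qed.

Lemma lexlt_map (T : eqType) (L : seq T) (f g : T -> nat) : uniq L ->
  lexlt (map f L) (map g L) <->
  exists2 v, v \in L & f v < g v /\ forall u, u \in L -> index u L < index v L -> f u = g u.
Proof.
move=> uL; split=> [[i []]|[v vL [lt H]]].
  rewrite size_map => iL; have [x0] : exists x0 : T, True by case: (L) iL => // x; exists x.
  rewrite !(nth_map x0) // => _ lt H; exists (nth x0 L i); first exact: mem_nth.
  split=> // u uu; rewrite index_uniq // => ui; have := H _ ui.
  by rewrite !(nth_map x0) ?index_mem // nth_index.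
exists (index v L); rewrite size_map index_mem !(nth_map v) ?index_mem // nth_index //; split=> // j jv.
have jL : j < size L by rewrite (ltn_trans jv) ?index_mem.
by rewrite !(nth_map v) // H ?mem_nth // index_uniq.
Qed.

(** Induction on the number of codes available below [x]: below a predecessor [y] the code of [y] is
    no longer available. Finiteness is required of the codes, not of [T]. *)
Lemma finite_well_founded (T : Type) (K : eqType) (code : T -> K) (lt : T -> T -> Prop) (L : seq K) :
  (forall x, code x \in L) -> (forall x y, code x = code y -> ~ lt x y) ->
  (forall x y z, lt x y -> lt y z -> lt x z) -> well_founded lt.
Proof.
move=> cL irr tr.
suff H n (L' : seq K) : size L' < n -> forall x, (forall y, lt y x -> code y \in L') -> Acc lt x.
  by move=> x; apply: (H (size L).+1 L).
elim: n L' => [|n IH] L'; first by rewrite ltn0.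
move=> sL x Hx.
apply: Acc_intro => y yx.
have yL := Hx _ yx.
apply: (IH [seq k <- L' | k != code y]).
  rewrite size_filter.
  have E : count (pred1 (code y)) L' + count (fun k => k != code y) L' = size L'.
    exact: count_predC.
  have P : 0 < count (pred1 (code y)) L' by rewrite -has_count has_pred1.
  by rewrite -E ltnS in sL; apply: leq_trans sL; rewrite -add1n leq_add2r.
move=> z zy; rewrite mem_filter Hx ?andbT; last exact: tr zy yx.
by apply/eqP => E; exact: irr E zy.
Qed.

Lemma all_ord B s : all (fun k => k < B) s -> exists os : seq 'I_B, map val os = s.
Proof.
elim: s => [|k s IH] /=; first by exists [::].
by case/andP => kB /IH[os <-]; exists (Ordinal kB :: os).
Qed.

Section Order.
Variables (c c' : tgraph).

(** Vertices are listed over the target, half-edges over the source: composing with a further map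
    keeps the values of the first list and the positions of the second. Hence [vcode] may contain
    raw vertex numbers, while [hcode] uses ranks, whose comparison survives by [tm_mono]. *)
Definition vcode (x : cmap) := [seq x.1 v | v <- tvs c'].
Definition hcode (x : cmap) := [seq hrk c' (x.2 h) | h <- ths c].
Definition code x := vcode x ++ hcode x.

Lemma size_code x : size (code x) = size (tvs c') + size (ths c).
Proof. by rewrite size_cat !size_map. Qed.

Lemma code_dec x : tmor c c' x -> code (dec (enc (tgr c) (tgr c') x)) = code x.
Proof.
move=> X; congr (_ ++ _).
  by apply/eq_in_map => v; rewrite mem_tvs => vn; rewrite dec_enc_f.
by apply/eq_in_map => h; rewrite mem_ths => hh; rewrite dec_enc_g //; apply: tm_con.
Qed.

Lemma code_inj x y : tmor c c' x -> tmor c c' y -> code x = code y ->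
  enc (tgr c) (tgr c') x = enc (tgr c) (tgr c') y.
Proof.
move=> X Y /eqP; rewrite eqseq_cat ?size_map // => /andP[/eqP/eq_in_map E1 /eqP/eq_in_map E2].
apply: eq_enc => [k kn|e he]; first by apply: E1; rewrite mem_tvs.
apply: (@hrk_inj c'); try by [case: (con_g (tm_con X) he) | case: (con_g (tm_con Y) he)].
by apply: E2; rewrite mem_ths.
Qed.

Lemma code_bound x : tmor c c' x -> all (fun k => k < nverts (tgr c) + size (ths c')) (code x).
Proof.
move=> X; rewrite all_cat; apply/andP; split; apply/allP => _ /mapP[v H ->].
  by rewrite mem_tvs in H; rewrite ltn_addr // (con_f (tm_con X)).
rewrite mem_ths in H; rewrite ltn_addl // /hrk index_mem mem_ths.
by case: (con_g (tm_con X) H).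
Qed.
End Order.

(** A first difference at a vertex [v] reappears first at the top [s v] of its fibre, since anything
    earlier than [s v] lies over something earlier than [v]. For half-edges the monotonicity of
    [y.2] suffices. *)
Lemma code_comp c c' c'' x x' y : tmor c c' x -> tmor c c' x' -> tmor c' c'' y ->
  lexlt (code c c' x) (code c c' x') -> lexlt (code c c'' (ccmp y x)) (code c c'' (ccmp y x')).
Proof.
move=> X X' Y; rewrite !lexlt_cat ?size_map //.
have [s [S1 S2 S3 S4 S5]] := tm_sec Y.
case=> [/(lexlt_map _ _ (uniq_tvs c'))[v]|[/eq_in_map E /(lexlt_map _ _ (uniq_ths c))[h]]].
  rewrite mem_tvs => vn [lt H]; left; apply/(lexlt_map _ _ (uniq_tvs c'')); have [sn sv] := S2 _ vn.
  exists (s v); first by rewrite mem_tvs.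
  rewrite /= sv; split=> // u; rewrite mem_tvs => un usv.
  have yn := con_f (tm_con Y) un; apply: H; first by rewrite mem_tvs.
  rewrite ltnNge; apply/negP => le.
  have le2 : vrk c'' (s v) <= vrk c'' (s (y.1 u)).
    move: le; rewrite leq_eqVlt => /orP[/eqP/(vrk_inj vn yn) <- //|lt'].
    by apply/ltnW/S3.
  have le3 : vrk c'' (s (y.1 u)) <= vrk c'' u.
    by have [<-//|/(S5 _ un)[/ltnW]] := eqVneq u (s (y.1 u)).
  by move: (leq_ltn_trans (leq_trans le2 le3) usv); rewrite ltnn.
rewrite mem_ths => hh [lt H]; right; split.
  apply/eq_in_map => u; rewrite mem_tvs => un /=; apply: E.
  by rewrite mem_tvs (con_f (tm_con Y)).
apply/(lexlt_map _ _ (uniq_ths c)); exists h; first by rewrite mem_ths.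
have hx e : is_he (tgr c) e -> is_he (tgr c') (x.2 e) /\ is_he (tgr c') (x'.2 e).
  by move=> he; have [? _] := con_g (tm_con X) he; have [? _] := con_g (tm_con X') he.
split=> /=; first by have [? ?] := hx h hh; apply: (tm_mono Y).
move=> u; rewrite mem_ths => hu uh; congr hrk; congr y.2.
have [? ?] := hx u hu; apply: (@hrk_inj c') => //; apply: H => //.
by rewrite mem_ths.
Qed.

Lemma tCat_admissible (c : Ob tCat) : exists lt, @admissible_order tCat c lt.
Proof.
(* A morphism stores no contraction map; [dec] supplies one, with the same code as any other by
   [code_dec]. *)
pose cd c' (f : tHom c c') := code c c' (dec (sval f)).
have cdE c' (f : tHom c c') : exists2 x, tmor c c' x & cd c' f = code c c' x /\ sval f = enc (tgr c) (tgr c') x.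
  by have [x X E] := svalP f; exists x => //; split=> //; rewrite /cd E code_dec.
have sz c' (f g : tHom c c') : size (cd c' f) = size (cd c' g) by rewrite /cd !size_code.
exists (fun c' f g => lexlt (cd c' f) (cd c' g)); split.
  move=> c'; have tr (f g h : tHom c c') : lexlt (cd c' f) (cd c' g) -> lexlt (cd c' g) (cd c' h) ->
      lexlt (cd c' f) (cd c' h) by apply: lexlt_trans.
  split; [|split; [exact: tr|split]].
  - by move=> f; apply: lexlt_irr.
  - move=> f g; case: (lexlt_total (sz c' f g)) => [E|lt|lt]; [left|by right; left|by right; right].
    have [x X [Ex Mx]] := cdE c' f; have [y Y [Ey My]] := cdE c' g.
    by apply: tHom_eq; rewrite Mx My; apply: code_inj; rewrite // -Ex -Ey.
  - pose n := size (tvs c') + size (ths c); pose B := nverts (tgr c) + size (ths c').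
    apply: (@finite_well_founded _ _ (cd c') _ (map (fun t : n.-tuple 'I_B => map val t) (enum {: n.-tuple 'I_B}))) tr.
      move=> f; have [x X [-> _]] := cdE c' f.
      have [os osE] := all_ord (code_bound X).
      have sos : size os == n by rewrite -(size_map val) osE size_code.
      by apply/mapP; exists (Tuple sos); rewrite ?mem_enum.
    by move=> f g ->; apply: lexlt_irr.
move=> c' c'' g f f'; have [x X [Ex Mx]] := cdE c' f; have [x' X' [Ex' Mx']] := cdE c' f'.
have [y Y [_ My]] : exists2 y, tmor c' c'' y & True /\ sval g = enc (tgr c') (tgr c'') y.
  by have [y Y E] := svalP g; exists y.
have cdc h z : tmor c c' z -> sval h = enc (tgr c) (tgr c') z ->
    cd c'' (tcomp g h) = code c c'' (ccmp y z).
  move=> Z E; rewrite /cd /= E My (rcomp_tmor Z Y) code_dec //; exact: tmor_comp Z Y.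
rewrite Ex Ex' /= (cdc _ _ X Mx) (cdc _ _ X' Mx'); exact: code_comp.
Qed.

(** * Existence of spanning trees *)

Lemma path_crossing (T : finType) (e : rel T) (P : pred T) x y :
  connect e x y -> P x -> ~~ P y -> exists a b, [/\ P a, ~~ P b & e a b].
Proof.
case/connectP => s; elim: s x => [|z s IH] x /=; first by move=> _ -> ->.
case/andP => xz zs yE Px Py; case: (boolP (P z)) => Pz; first exact: IH zs yE Pz Py.
by exists x, z.
Qed.

Definition spans (q : rgraph) (ch : forest nat) (up : nat -> nat * nat) :=
  forall w y, (w, y) \in nodes 0 ch ->
    [/\ is_he q (up y), (up y).1 = y & (hinv q (up y)).1 = w].

(** Connectedness yields an edge leaving the set of vertices already reached; its far end is
    attached to its near end. *)
Lemma spanning_step q ch up : valid q -> uniq (0 :: pre ch) ->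
  {subset 0 :: pre ch <= iota 0 (nverts q)} -> size (0 :: pre ch) < nverts q -> spans q ch up ->
  exists ch' up', [/\ uniq (0 :: pre ch'), {subset 0 :: pre ch' <= iota 0 (nverts q)},
     size (pre ch') = (size (pre ch)).+1 & spans q ch' up'].
Proof.
move=> vq u0 sub lt sp; have n0 := valid_nverts vq; set vs := 0 :: pre ch in u0 sub lt.
have [y yn yN] : exists2 y, y < nverts q & y \notin vs.
  case: (boolP (all (mem vs) (iota 0 (nverts q)))) => [/allP H|/allPn[y]].
    by have := uniq_leq_size (iota_uniq 0 (nverts q)) H; rewrite size_iota leqNgt lt.
  by rewrite mem_iota; exists y.
have /forallP/(_ (Ordinal n0))/forallP/(_ (Ordinal yn)) := valid_connected vq.
case/(@path_crossing _ _ (fun v => val v \in vs)) => // a [b [aV bV /hasP[i]]].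
rewrite mem_iota /= add0n => ia /eqP hb.
have ha : is_he q (val a, i) by rewrite /is_he ltn_ord.
have [hh hK] := valid_hinv vq ha.
(* The root is made a node of the forest so that [insert] can also attach a vertex to it. *)
pose f := FCons 0 ch FNil.
have fvs : pre f = vs by rewrite /= cats0.
have [ch' fE] : exists ch', insert (val a) (val b) f = FCons 0 ch' FNil.
  by rewrite /= ; case: eqP => _; eexists.
have pf : perm_eq (0 :: pre ch') (val b :: vs).
  by have := @perm_insert _ (val a) (val b) f; rewrite fvs fE /= cats0; apply.
have u' : uniq (0 :: pre ch') by rewrite (perm_uniq pf) cons_uniq bV.
exists ch', (fun z => if z == val b then hinv q (val a, i) else up z); split=> //.
- move=> z; rewrite (perm_mem pf) inE => /predU1P[->|/sub //].
  by rewrite mem_iota ltn_ord.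
- by have := perm_size pf; case.
- move=> w z wz; have zc := nodes_pre wz.
  have : (w, z) \in nodes (nverts q) (insert (val a) (val b) f).
    by rewrite fE inE mem_cat wz orbT.
  case/nodes_insert => [[-> ->]|]; first by rewrite eqxx hK.
  rewrite inE mem_cat orbF => /predU1P[[_ z0]|wz'].
    by move: u'; rewrite /= -z0 zc.
  rewrite ifN; first exact: sp.
  by apply: contraNneq bV => <-; rewrite inE (nodes_pre wz') orbT.
Qed.

Lemma spanning_forest q : valid q ->
  exists ch up, perm_eq (0 :: pre ch) (iota 0 (nverts q)) /\ spans q ch up.
Proof.
move=> vq; have n0 := valid_nverts vq.
suff H k : k < nverts q -> exists ch up, [/\ uniq (0 :: pre ch),
    {subset 0 :: pre ch <= iota 0 (nverts q)}, size (pre ch) = k & spans q ch up].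
  have [|ch [up [u s sz sp]]] := H (nverts q).-1; first by rewrite prednK.
  exists ch, up; split=> //; apply: uniq_perm => //; first exact: iota_uniq.
  by apply: (uniq_min_size u s _).2; rewrite size_iota /= sz prednK.
elim: k => [_|k IH kn].
  exists FNil, (fun=> (0, 0)); split=> //= z; rewrite inE => /eqP ->.
  by rewrite mem_iota.
have [|ch [up [u s sz sp]]] := IH; first exact: ltnW.
by rewrite -sz; apply: spanning_step sp; rewrite //= sz.
Qed.

Lemma tgraph_exists q : validb q -> exists c : tgraph, tgr c = q.
Proof.
move=> vb; have /validP vq := vb.
have [ch [up [pe sp]]] := spanning_forest vq.
have u0 : uniq (0 :: pre ch) by rewrite (perm_uniq pe) iota_uniq.
pose rk v := index v (0 :: pre ch).
have P v : v \in pre ch -> [/\ is_he q (up v), (up v).1 = v, is_he q (hinv q (up v)),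
    hinv q (hinv q (up v)) = up v & rk (hinv q (up v)).1 < rk v].
  case/(pre_nodes 0) => w H; have [h1 h2 h3] := sp _ _ H.
  have [h4 h5] := valid_hinv vq h1; split=> //.
  by rewrite h3; apply: nodes_index.
pose T := flatten [seq [:: up v; hinv q (up v)] | v <- pre ch].
have nl v : v \in pre ch -> up v != hinv q (up v).
  by case/P => h1 h2 h3 h4 h5; apply: contraTneq h5 => <-; rewrite h2 ltnn.
have neq v w : v \in pre ch -> w \in pre ch -> up v != hinv q (up w).
  move=> vc wc; apply/negP => /eqP E.
  have [v1 v2 v3 v4 v5] := P v vc; have [w1 w2 w3 w4 w5] := P w wc.
  by move: v5; rewrite E w4 w2 -{1}v2 E ltnNge ltnW.
have uT : uniq T.
  rewrite /T; move: u0 => /= /andP[_]; elim: (pre ch) P nl neq => //= v s IH P nl neq /andP[vs us].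
  have vv : v \in v :: s by rewrite inE eqxx.
  have ss w : w \in s -> w \in v :: s by rewrite inE orbC => ->.
  have {}IH := IH (fun w ws => P w (ss w ws)) (fun w ws => nl w (ss w ws))
     (fun a b as_ bs => neq a b (ss a as_) (ss b bs)) us.
  have upI w : w \in s -> up v != up w.
    move=> ws; apply: contraNneq vs => E; have [_ <- _ _ _] := P v vv.
    by rewrite E; have [_ -> _ _ _] := P w (ss _ ws).
  rewrite inE negb_or nl // IH andbT /=; apply/andP; split; apply/flatten_mapP => -[w ws]; rewrite !inE.
    by rewrite (negbTE (upI _ ws)) (negbTE (neq _ _ vv (ss _ ws))).
  rewrite eq_sym (negbTE (neq _ _ (ss _ ws) vv)) /= => /eqP E.
  have [_ _ _ v4 _] := P v vv; have [_ _ _ w4 _] := P w (ss _ ws).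
  by have := upI w ws; rewrite -v4 E w4 eqxx.
have Th h : h \in T -> is_he q h.
  by case/flatten_mapP => v /P[h1 _ h2 _ _]; rewrite !inE => /orP[] /eqP ->.
have Tl h : h \in T -> h \notin rleaves q.
  move=> hT; rewrite -(valid_leafE vq (Th _ hT)); case/flatten_mapP: hT => v vc.
  have [_ _ _ h4 _] := P v vc.
  by rewrite !inE => /orP[] /eqP ->; rewrite ?h4 ?nl // eq_sym nl.
(* Any order of the remaining half-edges would do; that of [hes] is taken. *)
pose X := [seq h <- hes q | (h \notin rleaves q) && (h \notin T)].
have pT : perm_eq ((rleaves q ++ X) ++ T) (hes q).
  apply: uniq_perm; last 1 first.
  - move=> h; rewrite !mem_cat mem_filter !mem_hes.
    case: (boolP (h \in rleaves q)) => [/(valid_leaf_he vq) ->//|_].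
    by case: (boolP (h \in T)) => [/Th ->|_]; rewrite ?orbT ?orbF.
  - rewrite !cat_uniq (valid_uniq_leaves vq) filter_uniq ?uniq_hes // uT !andbT /=.
    apply/andP; split; apply/hasPn => h; first by rewrite mem_filter => /andP[/andP[]].
    by move=> hT; rewrite mem_cat negb_or Tl // mem_filter hT andbF.
  - exact: uniq_hes.
by exists (@TGraph q 0 ch up X vb pe sp pT).
Qed.

(** * From embeddings of spanning trees to morphisms *)

Lemma subseq_index (T : eqType) (s t : seq T) a b : uniq t -> subseq s t -> a \in s -> b \in s ->
  index a s < index b s -> index a t < index b t.
Proof.
elim: t s => [|z t IH] [|y s] //= /andP[zt ut].
have [<-|yz] := eqVneq y z.
  move=> st; rewrite !inE; have [<-|ya] := eqVneq y a; have [<-|yb] := eqVneq y b => //=.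
  by rewrite !ltnS; apply: IH.
move=> st ain bin lt; have at_ := mem_subseq st ain; have bt := mem_subseq st bin.
rewrite !ifN; first exact: (IH _ ut st).
  by apply: contraNneq zt => ->.
by apply: contraNneq zt => ->.
Qed.

Lemma subseq_map_index (T U : eqType) (g : T -> U) (s : seq T) (t : seq U) a b :
  uniq t -> subseq (map g s) t -> a \in s -> b \in s ->
  index a s < index b s -> index (g a) t < index (g b) t.
Proof.
move=> ut st ain bin lt; have um := subseq_uniq st ut.
have ix x : x \in s -> index (g x) (map g s) = index x s.
  move=> xs; have := index_uniq (g x) (i := index x s) _ um.
  by rewrite size_map index_mem (nth_map x) ?index_mem // nth_index // => ->.
by apply: (subseq_index ut st); rewrite ?map_f // !ix.
Qed.

Lemma subseq_flatten (T U : eqType) (F : T -> seq U) (s t : seq T) : subseq s t ->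
  subseq (flatten (map F s)) (flatten (map F t)).
Proof.
elim: t s => [|z t IH] [|y s] //=; first by rewrite sub0seq.
case: eqP => [->|_] /IH; first by rewrite subseq_cat2l.
by move/subseq_trans; apply; apply: suffix_subseq.
Qed.

Lemma eq_sum_seq (T : eqType) (s : seq T) (f g : T -> nat) : (forall v, v \in s -> f v <= g v) ->
  \sum_(v <- s) f v = \sum_(v <- s) g v -> forall v, v \in s -> f v = g v.
Proof.
elim: s => // a s IH H; rewrite !big_cons => E.
have Ha : f a <= g a by apply: H; rewrite inE eqxx.
have Hs v : v \in s -> f v <= g v by move=> vs; apply: H; rewrite inE vs orbT.
have le : \sum_(v <- s) f v <= \sum_(v <- s) g v by rewrite big_seq [X in _ <= X]big_seq; apply: leq_sum.
by move=> v; rewrite inE => /predU1P[->|]; [lia | apply: IH => //; lia].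
Qed.

(** What equal labels say about [v] and [v']. Half-edges outside the tree are compared by position
    in [tspec], half-edges of [d] on a tree edge by the child end of that edge. The tests
    [v \in pre (tch c)] guard against the junk value of [tup] at the root. *)
Record loc_match (d : rgraph) (c c' : tgraph) (x x' : cmap) (v v' : nat) : Prop := LocMatch {
  lm_f : x.1 v = x'.1 v';
  lm_gen : nth 0 (rgen (tgr c)) v = nth 0 (rgen (tgr c')) v';
  lm_spec : forall i, i < size (tspec c) ->
    ((nth (0, 0) (tspec c) i).1 == v) = ((nth (0, 0) (tspec c') i).1 == v');
  lm_up : forall h, is_he d h -> (v \in pre (tch c)) && (x.2 h == tup c v) =
    (v' \in pre (tch c')) && (x'.2 h == tup c' v');
  lm_down : forall h, is_he d h -> (v \in pre (tch c)) && (x.2 h == hinv (tgr c) (tup c v)) =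
    (v' \in pre (tch c')) && (x'.2 h == hinv (tgr c') (tup c' v')) }.

(** With these data the half-edges outside the tree, their pairing and those coming from [d] agree
    position by position. *)
Record glob_match (d : rgraph) (c c' : tgraph) (x x' : cmap) : Prop := GlobMatch {
  gm_size : size (tspec c) = size (tspec c');
  gm_gen : \sum_(v <- iota 0 (nverts (tgr c))) nth 0 (rgen (tgr c)) v =
           \sum_(v <- iota 0 (nverts (tgr c'))) nth 0 (rgen (tgr c')) v;
  gm_inv : forall i, i < size (tspec c) ->
    index (hinv (tgr c) (nth (0, 0) (tspec c) i)) (tspec c) =
    index (hinv (tgr c') (nth (0, 0) (tspec c') i)) (tspec c');
  gm_ix : forall h, is_he d h -> index (x.2 h) (tspec c) = index (x'.2 h) (tspec c') }.

Section Embed.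
Variables (d : rgraph) (c c' : tgraph) (x x' : cmap) (R : nat -> nat -> Prop).
Hypotheses (X : contraction d (tgr c) x) (X' : contraction d (tgr c') x').
Hypothesis RM : forall v v', v < nverts (tgr c) -> v' < nverts (tgr c') -> R v v' ->
  loc_match d c c' x x' v v' /\ glob_match d c c' x x'.
Let q := tgr c. Let r := tgr c'.
Let p := nverts q. Let p' := nverts r.
Let f := FCons (troot c) (tch c) FNil. Let g := FCons (troot c') (tch c') FNil.
Variables (phi pi : nat -> nat).
Hypothesis E : embedding R p f p' g phi pi.

Let pf : pre f = tvs c. Proof. by rewrite /= cats0. Qed.
Let pg : pre g = tvs c'. Proof. by rewrite /= cats0. Qed.

(** [p] is the virtual parent of the root, so [pi w == p] means that no image of [phi] lies at or
    above [w]; such vertices join the fibre of [troot c]. The top of that fibre is therefore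
    [troot c'] rather than [phi (troot c)], whence the exception in [sec]. *)
Let vf w := if pi w == p then troot c else pi w.
Let sec v := if v == troot c then troot c' else phi v.

Let phi_lt v : v < p -> phi v < p'.
Proof.
move=> vp; rewrite -mem_tvs -pg; apply: (mem_subseq (emb_subseq E)).
by rewrite map_f // pf mem_tvs.
Qed.
Let loc v : v < p -> loc_match d c c' x x' v (phi v).
Proof.
move=> vp; apply: (RM vp (phi_lt vp) _).1; apply: (emb_R E).
by rewrite pf mem_tvs.
Qed.
Let glob : glob_match d c c' x x'.
Proof.
have rp : troot c < p by exact: troot_lt.
by apply: (RM rp (phi_lt rp) _).2; apply: (emb_R E); rewrite pf mem_tvs.
Qed.
Let phiK v : v < p -> vf (phi v) = v.
Proof. by move=> vp; rewrite /vf (emb_K E) ?pf ?mem_tvs // ltn_eqF. Qed.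
Let phiI v w : v < p -> w < p -> phi v = phi w -> v = w.
Proof. by move=> vp wp e; rewrite -(phiK vp) e phiK. Qed.
Let phi_sub : subseq (map phi (pre (tch c))) (pre (tch c')).
Proof.
have := emb_subseq E; rewrite pf pg /=; case: eqP => // _.
by apply: subseq_trans; apply: subseq_cons.
Qed.
Let phi_ch v : v \in pre (tch c) -> phi v \in pre (tch c').
Proof. by move=> vc; apply: (mem_subseq phi_sub); rewrite map_f. Qed.

Let vf_root : vf (troot c') = troot c.
Proof.
have : (p', troot c') \in nodes p' g by rewrite /= inE eqxx.
case/(emb_nodes E) => [[v]|[_ e]]; last by rewrite /vf e (emb_root E) eqxx.
rewrite (emb_root E) /= cats0 inE => /predU1P[[->] ->|H _]; first by rewrite phiK ?troot_lt.
by have := nodes1 H; rewrite -/(tvs c) mem_tvs ltnn.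
Qed.

Let par w := (hinv r (tup c' w)).1.

(** The image of the root counts as outside: if [phi (troot c)] is not [troot c'], the edge above it
    is contracted. *)
Let nodeP w : w \in pre (tch c') ->
  (exists2 v, v \in pre (tch c) & [/\ w = phi v, vf w = v & vf (par w) = (hinv q (tup c v)).1]) \/
  (w \notin map phi (pre (tch c)) /\ vf w = vf (par w)).
Proof.
move=> wc; have [u uw] := pre_nodes (troot c') wc; have [_ _ uE] := tup_nodes uw.
have : (u, w) \in nodes p' g by rewrite /= inE mem_cat uw orbT.
rewrite /par uE => /(emb_nodes E)[[v]|[wN e]]; last first.
  right; split; last by rewrite /vf e.
  by apply: contra wN => /mapP[v vc ->]; rewrite map_f // pf inE vc orbT.
rewrite /= cats0 inE => /predU1P[[e ->] ->|uv wE].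
  right; split; last by rewrite phiK ?troot_lt // /vf e eqxx.
  apply/mapP => -[v' vc /phiI e']; have := uniq_tvs c.
  by rewrite /tvs /= e' ?vc ?troot_lt ?tch_lt.
have vc := nodes_pre uv; left; exists v => //; split=> //; first by rewrite wE phiK ?tch_lt.
have [_ _ ->] := tup_nodes uv; rewrite /vf ltn_eqF //.
by rewrite -mem_tvs; apply: nodes1 uv.
Qed.

Let par_lt w : w \in pre (tch c') -> par w < p'.
Proof. by case/tupP => _ _ _ _ /andP[]. Qed.
Let par_rk w : w \in pre (tch c') -> vrk c' (par w) < vrk c' w.
Proof. by case/tupP. Qed.

Let node_ind (P : nat -> Prop) : P (troot c') ->
  (forall w, w \in pre (tch c') -> P (par w) -> P w) -> forall w, w < p' -> P w.
Proof.
move=> P0 Ps w; have [k] := ubnP (vrk c' w); elim: k w => // k IH w lt wp.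
move: (wp); rewrite -mem_tvs inE => /predU1P[->//|wc]; apply: Ps => //.
apply: IH; last exact: par_lt.
exact: leq_trans (par_rk wc) _.
Qed.

Let vf_lt w : w < p' -> vf w < p.
Proof.
move: w; apply: node_ind => [|w wc IH]; first by rewrite vf_root troot_lt.
case: (nodeP wc) => [[v vc [_ -> _]]|[_ ->]] //; exact: tch_lt.
Qed.

Let sec_ch v : v \in pre (tch c) -> sec v = phi v.
Proof.
move=> vc; rewrite /sec ifN //; apply: contraTneq vc => ->.
by have := uniq_tvs c; case/andP.
Qed.
Let sec_lt v : v < p -> sec v < p' /\ vf (sec v) = v.
Proof.
move=> vp; rewrite /sec; case: eqP => [->|_]; first by rewrite troot_lt vf_root.
by rewrite phi_lt // phiK.
Qed.

Let sec_or w : w < p' -> w = sec (vf w) \/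
  [/\ w \in pre (tch c'), w \notin map phi (pre (tch c)) & vf w = vf (par w)].
Proof.
rewrite -mem_tvs inE => /predU1P[->|wc]; first by left; rewrite vf_root /sec eqxx.
case: (nodeP wc) => [[v vc [wE -> _]]|[H1 H2]]; last by right.
by left; rewrite sec_ch.
Qed.

Let sec_le w : w < p' -> vrk c' (sec (vf w)) <= vrk c' w.
Proof.
move: w; apply: node_ind => [|w wc IH]; first by rewrite vf_root /sec eqxx.
case: (sec_or (tch_lt wc)) => [<- //|[_ _ ->]].
exact: leq_trans IH (ltnW (par_rk wc)).
Qed.

(* On tree half-edges [hf] is [phi]; the edge above [phi v] replaces the edge above [v]. *)
Let hf h := if h \in tspec c then nth (0, 0) (tspec c') (index h (tspec c))
  else if (h.1 \in pre (tch c)) && (h == tup c h.1) then tup c' (phi h.1)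
  else hinv r (tup c' (phi (hinv q h).1)).

Let hf_spec i : i < size (tspec c) -> hf (nth (0, 0) (tspec c) i) = nth (0, 0) (tspec c') i.
Proof. by move=> i_lt; rewrite /hf mem_nth // index_uniq ?uniq_tspec. Qed.
Let hf_up v : v \in pre (tch c) -> hf (tup c v) = tup c' (phi v).
Proof.
move=> vc; have [_ v2 _ _ _] := tupP vc.
by rewrite /hf (negbTE (ttree_notin_spec (mem_ttree_up vc))) v2 vc eqxx.
Qed.
Let hf_down v : v \in pre (tch c) -> hf (hinv q (tup c v)) = hinv r (tup c' (phi v)).
Proof.
move=> vc; have [v1 v2 _ _ _] := tupP vc.
rewrite /hf (negbTE (ttree_notin_spec (mem_ttree_dn vc))) ifN; last first.
  by apply/andP => -[wc /eqP e]; have := tup_neq_hinv wc vc; rewrite -e eqxx.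
by rewrite (valid_hinv (tg_valid c) v1).2 v2.
Qed.

Let map_hf_spec : map hf (tspec c) = tspec c'.
Proof.
apply: (@eq_from_nth _ (0, 0)); rewrite size_map ?(gm_size glob) // => i i_lt.
by rewrite (nth_map (0, 0)) ?hf_spec ?(gm_size glob).
Qed.

(** Half-edges outside the tree correspond in order, and tree half-edges are listed by the preorder,
    which [phi] preserves. *)
Let map_hf : subseq (map hf (ths c)) (ths c').
Proof.
rewrite map_cat map_hf_spec /ths subseq_cat2l /ttree map_flatten -map_comp.
have -> : [seq (map hf \o (fun v => [:: tup c v; hinv (tgr c) (tup c v)])) v | v <- pre (tch c)] =
  [seq [:: tup c' v; hinv (tgr c') (tup c' v)] | v <- map phi (pre (tch c))].
  by rewrite -map_comp; apply/eq_in_map => v vc /=; rewrite hf_up // hf_down.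
exact: subseq_flatten.
Qed.

Let hf_mono h h' : is_he q h -> is_he q h' -> hrk c h < hrk c h' -> hrk c' (hf h) < hrk c' (hf h').
Proof. by rewrite -!mem_ths; apply: subseq_map_index (uniq_ths c') map_hf. Qed.

Let hf_inj h h' : is_he q h -> is_he q h' -> hf h = hf h' -> h = h'.
Proof.
move=> hh hh' e; apply: (hrk_inj hh hh').
have := hf_mono hh hh'; have := hf_mono hh' hh; rewrite e ltnn.
by case: ltngtP => // _ H H'; [have := H isT | have := H' isT].
Qed.

Let hf_he e : is_he q e -> is_he r (hf e) /\ vf (hf e).1 = e.1.
Proof.
move=> he; case: (heP he) => [i i_lt|v vc|v vc].
- rewrite hf_spec //; have i_lt' : i < size (tspec c') by rewrite -(gm_size glob).
  split; first by apply: tspec_he; rewrite mem_nth.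
  have /andP[e1 _] := tspec_he (mem_nth (0, 0) i_lt).
  by have /esym := lm_spec (loc e1) i_lt; rewrite eqxx => /eqP ->; rewrite phiK.
- have [h1 h2 _ _ _] := tupP vc; have [h1' h2' _ _ _] := tupP (phi_ch vc).
  by rewrite hf_up // h2' phiK ?h2 ?tch_lt.
- have [h1 h2 _ _ h5] := tupP vc; have [h1' h2' _ _ h5'] := tupP (phi_ch vc).
  rewrite hf_down //; split=> //; case: (nodeP (phi_ch vc)) => [[w wc [e' _ ->]]|[]].
    by rewrite (phiI (tch_lt vc) (tch_lt wc) e').
  by rewrite map_f.
Qed.

Let up_out w : w \in pre (tch c') -> w \notin map phi (pre (tch c)) ->
  forall e, is_he q e -> hf e != tup c' w.
Proof.
move=> wc wN e he; have nspec := ttree_notin_spec (mem_ttree_up wc).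
case: (heP he) => [i i_lt|v vc|v vc].
- by rewrite hf_spec //; apply: contraNneq nspec => <-; rewrite mem_nth // -(gm_size glob).
- rewrite hf_up //; apply: contraNneq wN => e'.
  have [_ h2 _ _ _] := tupP wc; have [_ h2' _ _ _] := tupP (phi_ch vc).
  by apply/mapP; exists v => //; rewrite -h2 -e' h2'.
- by rewrite hf_down // eq_sym; apply: tup_neq_hinv => //; apply: phi_ch.
Qed.

Let out_tree h : is_he r h -> (forall e, is_he q e -> hf e != h) ->
  exists w, [/\ w \in pre (tch c'), w \notin map phi (pre (tch c)) & h = tup c' w \/ h = hinv r (tup c' w)].
Proof.
move=> hh N; case: (heP hh) N => [i i_lt|w wc|w wc] N.
- rewrite -(gm_size glob) in i_lt; have := N (nth (0, 0) (tspec c) i).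
  by rewrite hf_spec // eqxx => H; have := H (tspec_he (mem_nth _ i_lt)).
- exists w; split=> //; last by left.
  apply/mapP => -[v vc e]; have [h1 _ _ _ _] := tupP vc.
  by have := N _ h1; rewrite hf_up // e eqxx.
- exists w; split=> //; last by right.
  apply/mapP => -[v vc e]; have [_ _ _ _ h1] := tupP vc.
  by have := N _ h1; rewrite hf_down // e eqxx.
Qed.

Let vf_par w : w \in pre (tch c') -> w \notin map phi (pre (tch c)) -> vf w = vf (par w).
Proof.
move=> wc wN; case: (nodeP wc) => [[v vc [e _ _]]|[]//].
by rewrite e map_f in wN.
Qed.

Lemma contraction_embedding : contraction q r (vf, hf).
Proof.
split=> /=.
- exact: vf_lt.
- exact: hf_he.
- exact: hf_inj.
- move=> e he _; case: (heP he) => [i i_lt|v vc|v vc].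
  + have hs := hinv_tspec (mem_nth (0, 0) i_lt); rewrite hf_spec // -/q.
    have j_lt := hs; rewrite -index_mem in j_lt.
    rewrite -[in RHS](nth_index (0, 0) hs) hf_spec // (gm_inv glob) // nth_index //.
    by apply: hinv_tspec; rewrite mem_nth // -(gm_size glob).
  + by rewrite hf_up // hf_down.
  + have [h1 _ _ _ _] := tupP vc; have [h1' _ _ _ _] := tupP (phi_ch vc).
    by rewrite hf_down // !(valid_hinv (tg_valid _) _).2 // hf_up.
(* Both graphs have as many leaves as [d], so the matching of the lists [tspec] splits into leaves
   and the rest. *)
- have := map_hf_spec; rewrite map_cat => /eqP; rewrite eqseq_cat; first by case/andP => /eqP ->.
  by rewrite size_map (con_leaves X) (con_leaves X') !size_map.
- move=> h hh N; have [w [wc wN]] := out_tree hh N.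
  have [h1 h2 _ _ _] := tupP wc.
  case=> ->; rewrite ?(valid_hinv (tg_valid c') h1).2 h2 -/(par w) (vf_par wc wN) //.
Qed.

Lemma tmor_embedding : tmor c c' (vf, hf).
Proof.
split=> //=.
- exact: contraction_embedding.
- exists sec; split.
  + by rewrite /sec eqxx.
  + exact: sec_lt.
  + move=> u v un vn lt; have vc : v \in pre (tch c) by rewrite -vrk_gt0 // (leq_ltn_trans _ lt).
    rewrite (sec_ch vc) /sec; case: eqP => [_|/eqP ur].
      by rewrite vrk_root vrk_gt0 ?phi_ch ?phi_lt.
    have := emb_subseq E; rewrite pf pg => st.
    by apply: (subseq_map_index (uniq_tvs c') st); rewrite ?mem_tvs.
  + by move=> v vc; rewrite sec_ch // hf_up.
  + move=> w wn wN; case: (sec_or wn) => [e|[wc wN' e]]; first by rewrite -e eqxx in wN.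
    split; last exact: up_out.
    by rewrite e; apply: leq_ltn_trans (sec_le (par_lt wc)) (par_rk wc).
- by move=> h hh /(out_tree hh)[w [wc _ H]]; exists w.
- (* [phi] preserves genera and the total genera agree, so there is no genus outside its image. *)
  suff H : forall v, v \in iota 0 p -> nth 0 (rgen q) v =
     \sum_(w <- fibre p' vf v) nth 0 (rgen r) w by move=> v vn; apply: H; rewrite mem_iota.
  apply: eq_sum_seq => [v|].
    rewrite mem_iota /= add0n => vp; rewrite (lm_gen (loc vp)).
    by rewrite (bigD1_seq (phi v)) ?uniq_fibre ?leq_addr //= mem_fibre phiK // eqxx phi_lt.
  by rewrite (gm_gen glob) (@sum_fibre p p' vf xpredT).
Qed.

(** A contracted tree edge carries no half-edge of [d]: by the labels these land outside the tree or
    on the edge above some [phi v] with [v] not the root. So [x'] is constant along contracted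
    edges, hence on the fibres of [vf]. *)
Let root_color w : w < p' -> x'.1 w = x'.1 (sec (vf w)).
Proof.
move: w; apply: node_ind => [|w wc IH]; first by rewrite vf_root /sec eqxx.
case: (sec_or (tch_lt wc)) => [<- //|[_ wN ->]]; rewrite -IH.
have [h1 h2 _ _ _] := tupP wc; rewrite -{1}h2 -(con_fib X' h1) // => e he.
have nspec := ttree_notin_spec (mem_ttree_up wc).
have [xe _] := con_g X he; have G := gm_ix glob he.
have U v (vc : v \in pre (tch c)) := lm_up (loc (tch_lt vc)) he.
have D v (vc : v \in pre (tch c)) := lm_down (loc (tch_lt vc)) he.
case: (heP xe) G U D => [i i_lt|v vc|v vc] G U D.
- rewrite index_uniq ?uniq_tspec // in G; apply: contraNneq nspec => <-.
  by rewrite -index_mem -G -(gm_size glob).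
- have /esym := U v vc; rewrite vc eqxx (phi_ch vc) => /eqP ->.
  apply: contraNneq wN => e'; have [_ h2' _ _ _] := tupP (phi_ch vc).
  by apply/mapP; exists v => //; rewrite -h2 -e' h2'.
- have /esym := D v vc; rewrite vc eqxx (phi_ch vc) => /eqP ->.
  by rewrite eq_sym; apply: tup_neq_hinv => //; apply: phi_ch.
Qed.

Lemma embedding_f w : w < p' -> x.1 (vf w) = x'.1 w.
Proof.
move=> wp; rewrite (root_color wp); have vp := vf_lt wp.
(* [phi] and [sec] may differ at the root; the second use of [root_color] passes from one to the
   other. *)
rewrite (lm_f (loc vp)) (root_color (phi_lt vp)) phiK //.
Qed.

Lemma embedding_g h : is_he d h -> hf (x.2 h) = x'.2 h.
Proof.
move=> he; have [xe _] := con_g X he; have G := gm_ix glob he.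
have U v (vc : v \in pre (tch c)) := lm_up (loc (tch_lt vc)) he.
have D v (vc : v \in pre (tch c)) := lm_down (loc (tch_lt vc)) he.
case: (heP xe) G U D => [i i_lt|v vc|v vc] G U D.
- rewrite index_uniq ?uniq_tspec // in G; rewrite hf_spec // G nth_index //.
  by rewrite -index_mem -G -(gm_size glob).
- by have /esym := U v vc; rewrite vc eqxx (phi_ch vc) hf_up // => /eqP ->.
- by have /esym := D v vc; rewrite vc eqxx (phi_ch vc) hf_down // => /eqP ->.
Qed.

Lemma embedding_tmor : exists y, [/\ tmor c c' y,
  forall k, k < p' -> x.1 (y.1 k) = x'.1 k & forall e, is_he d e -> y.2 (x.2 e) = x'.2 e].
Proof. by exists (vf, hf); split; [exact: tmor_embedding | exact: embedding_f | exact: embedding_g]. Qed.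
End Embed.

(** * Noetherianity and property (F) *)

Definition gsum (q : rgraph) := \sum_(v <- iota 0 (nverts q)) nth 0 (rgen q) v.

Section Bounds.
Variables (d q : rgraph) (x : cmap).
Hypothesis X : contraction d q x.
Hypothesis parts : forall l, l < nverts d -> valid (part d q x l) /\
  nth 0 (rgen d) l = sumn (rgen (part d q x l)) + genus (part d q x l).

Lemma gsum_le : gsum q <= gsum d.
Proof.
rewrite /gsum (@sum_fibre (nverts d) (nverts q) x.1 xpredT); last exact: con_f X.
rewrite big_seq [X in _ <= X]big_seq; apply: leq_sum => l; rewrite mem_iota /= add0n => ld.
by have [_ ->] := parts ld; rewrite sumnE big_map leq_addr.
Qed.

Lemma gen_le v : v < nverts q -> nth 0 (rgen q) v <= gsum q.
Proof. by move=> vq; rewrite /gsum (bigD1_seq v) ?iota_uniq ?mem_iota //= leq_addr. Qed.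

(** In each fibre the genus equation bounds the edges by genus plus vertices; this is summed over
    the fibres. The term in [nverts q] is paid for by the spanning tree in [size_tspec]. *)
Lemma size_hes_le : size (hes q) <= size (hes d) + (gsum d).*2 + (nverts q).*2.
Proof.
have -> : nverts q = \sum_(k <- iota 0 (nverts q)) 1 by rewrite sum1_size size_iota.
rewrite !size_hes /gsum -!muln2 !big_distrl /=.
rewrite !(@sum_fibre (nverts d) (nverts q) x.1 xpredT); try exact: con_f X.
rewrite -!big_split /= big_seq [X in _ <= X]big_seq; apply: leq_sum => l.
rewrite mem_iota /= add0n => ld; have [_ ->] := parts ld.
rewrite -(size_hes_sub q (legs d x.2 l)) ?uniq_fibre // -/(part d q x l).
rewrite -big_distrl /= sum1_size.
have : size (rleaves (part d q x l)) = deg d l by rewrite !size_map size_iota.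
have : nverts (part d q x l) = size (fibre (nverts q) x.1 l) by rewrite nverts_sub.
rewrite /genus; move: (size _) (size _) (size _) (nverts _) => a b e n; lia.
Qed.
End Bounds.

Lemma size_tspec (c : tgraph) : size (tspec c) + (nverts (tgr c)).*2 = size (hes (tgr c)) + 2.
Proof.
rewrite -(perm_size (thes_perm c)) -/(tspec c) -/(ttree c) -size_tvs [size (tvs c)]/=.
rewrite [size (_ ++ ttree c)]size_cat.
have -> : size (ttree c) = (size (pre (tch c))).*2.
  by rewrite /ttree; elim: (pre (tch c)) => //= v s ->.
by rewrite -addnA doubleS addn2.
Qed.

Section Label.
Variables (d : rgraph) (vd : valid d).
(** [N] bounds [size (tspec c)]: in [size_hes_le] combined with [size_tspec] the terms in [nverts]
    cancel. *)
Let n := nverts d. Let G := gsum d. Let M := size (hes d). Let N := M + G.*2 + 2.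
Let hd (j : 'I_M) := nth (0, 0) (hes d) j.

(** The first factor describes the vertex, the second the whole graph. *)
Definition label : finType :=
  (('I_n.+1 * 'I_G.+1 * {ffun 'I_N -> bool} * {ffun 'I_M -> bool} * {ffun 'I_M -> bool}) *
   ('I_N.+1 * 'I_G.+1 * {ffun 'I_N -> 'I_N.+1} * {ffun 'I_M -> 'I_N.+1}))%type.

(* Equal labels force agreement only when the components are within the bounds
   [n], [G] and [N], since [inord] sends larger numbers to 0. *)
Definition lab (c : tgraph) (x : cmap) (v : nat) : label :=
  ((inord (x.1 v), inord (nth 0 (rgen (tgr c)) v),
    [ffun i : 'I_N => (nth (0, 0) (tspec c) i).1 == v],
    [ffun j : 'I_M => (v \in pre (tch c)) && (x.2 (hd j) == tup c v)],
    [ffun j : 'I_M => (v \in pre (tch c)) && (x.2 (hd j) == hinv (tgr c) (tup c v))]),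
   (inord (size (tspec c)), inord (gsum (tgr c)),
    [ffun i : 'I_N => inord (index (hinv (tgr c) (nth (0, 0) (tspec c) i)) (tspec c))],
    [ffun j : 'I_M => inord (index (x.2 (hd j)) (tspec c))])).

Let inord_inj m a b : a <= m -> b <= m -> inord a = inord b :> 'I_m.+1 -> a = b.
Proof. by move=> am bm /(congr1 val); rewrite /= !inordK ?ltnS. Qed.

Definition decorated (c : tgraph) x := contraction d (tgr c) x /\
  forall l, l < nverts d -> valid (part d (tgr c) x l) /\
    nth 0 (rgen d) l = sumn (rgen (part d (tgr c) x l)) + genus (part d (tgr c) x l).

Let size_tspec_le c x : decorated c x -> size (tspec c) <= N.
Proof. by case=> X P; have := size_hes_le X P; have := size_tspec c; rewrite /N /M /G; lia. Qed.

Lemma lab_match c c' x x' v v' : decorated c x -> decorated c' x' ->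
  v < nverts (tgr c) -> v' < nverts (tgr c') -> lab c x v = lab c' x' v' ->
  loc_match d c c' x x' v v' /\ glob_match d c c' x x'.
Proof.
move=> D D' vc vc'; have sN := size_tspec_le D; have sN' := size_tspec_le D'.
have [X P] := D; have [X' P'] := D'.
have fl h : is_he d h -> exists j : 'I_M, h = hd j.
  rewrite -mem_hes => hh; have lt : index h (hes d) < M by rewrite index_mem.
  by exists (Ordinal lt); rewrite /hd nth_index.
have gl := gsum_le X P; have gl' := gsum_le X' P'.
case=> a1 a2 a3 a4 a5 a6 a7 a8 a9.
have ss : size (tspec c) = size (tspec c') by apply: inord_inj a6.
split; split.
- by apply: inord_inj a1; rewrite ltnW // ?(con_f X) ?(con_f X').
- by apply: inord_inj a2; [apply: leq_trans (gen_le vc) gl | apply: leq_trans (gen_le vc') gl'].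
- move=> i i_lt; have iN := leq_trans i_lt sN.
  by have /ffunP/(_ (Ordinal iN)) := a3; rewrite !ffunE.
- by move=> h /fl[j ->]; have /ffunP/(_ j) := a4; rewrite !ffunE.
- by move=> h /fl[j ->]; have /ffunP/(_ j) := a5; rewrite !ffunE.
- exact: ss.
- by apply: inord_inj a7.
- move=> i i_lt; have iN := leq_trans i_lt sN.
  have /ffunP/(_ (Ordinal iN)) := a8; rewrite !ffunE; apply: inord_inj.
    by apply: leq_trans sN; apply: index_size.
  by apply: leq_trans sN'; apply: index_size.
- move=> h /fl[j ->]; have /ffunP/(_ j) := a9; rewrite !ffunE; apply: inord_inj.
    by apply: leq_trans sN; apply: index_size.
  by apply: leq_trans sN'; apply: index_size.
Qed.

Lemma decorated_good (s : nat -> tgraph * cmap) : (forall i, decorated (s i).1 (s i).2) ->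
  exists i j, i < j /\ exists y, [/\ tmor (s i).1 (s j).1 y,
    forall k, k < nverts (tgr (s j).1) -> (s i).2.1 (y.1 k) = (s j).2.1 k &
    forall e, is_he d e -> y.2 ((s i).2.2 e) = (s j).2.2 e].
Proof.
(* With the root as a node the forest is never empty, so every embedding matches at least one label
   and gives access to the global data. *)
move=> D; pose F i := FCons (troot (s i).1) (tch (s i).1) FNil.
have [i [j [ij /femb_fmap e]]] := kruskal (fun i => fmap (lab (s i).1 (s i).2) (F i)).
exists i, j; split=> //.
have pf k : pre (F k) = tvs (s k).1 by rewrite /= cats0.
have nf k : nverts (tgr (s k).1) \notin pre (F k) by rewrite pf mem_tvs ltnn.
have uf k : uniq (pre (F k)) by rewrite pf uniq_tvs.
have [phi [pi E]] := femb_embedding 0 e (uf i) (uf j) (nf i) (nf j).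
apply: (embedding_tmor (D i).1 (D j).1 _ E) => v v'; exact: lab_match.
Qed.
End Label.

Lemma Dhom_decorated (d : ograph) (c : tgraph) (f : Dhom d (tF0 c)) :
  decorated (val d) c (dec (sval f)) /\ enc (val d) (tgr c) (dec (sval f)) = sval f.
Proof.
have m := svalP f; rewrite /= in m.
by split; [split; [exact: contraction_dec m | exact (@dec_parts _ _ _ m)] | exact: enc_dec m].
Qed.

Definition factors (d : ograph) (x y : {c : Ob tCat & Dhom d (tF0 c)}) : Prop :=
  exists g : Hom (projT1 x) (projT1 y), sval (projT2 y) = rcomp (sval (projT2 x)) (sval g).

Lemma factors_good (d : ograph) s : good (@factors d) s.
Proof.
have vd : valid (val d) by apply/validP/valP.
have [|i [j [ij [y [Y yf yg]]]]] := @decorated_good (val d)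
  (fun i => (projT1 (s i), dec (sval (projT2 (s i))))).
  by move=> i; case: (Dhom_decorated (projT2 (s i))).
exists i, j; split=> //.
have ex : exists2 x, tmor (projT1 (s i)) (projT1 (s j)) x &
   enc (tgr (projT1 (s i))) (tgr (projT1 (s j))) y = enc (tgr (projT1 (s i))) (tgr (projT1 (s j))) x by exists y.
exists (exist _ _ ex : tHom (projT1 (s i)) (projT1 (s j))).
rewrite [sval (exist _ _ _)]/=.
have [[X P] <-] := Dhom_decorated (projT2 (s i)); have [[X' P'] <-] := Dhom_decorated (projT2 (s j)).
rewrite (rcomp_enc vd (tg_valid _) (tg_valid _) X (tm_con Y)); last by move=> l /P[].
by apply/esym/eq_enc; [exact: yf | exact: yg].
Qed.

Lemma tCat_noetherian (c : Ob tCat) : @noetherian_under tCat c.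
Proof.
(* Morphisms of [tCat] are determined by their lists, so a factorization of the underlying morphisms
   through [g] already holds in [tCat]. *)
move=> s; have [i [j [ij [g gE]]]] := factors_good (d := tF0 c) (fun i => existT _ (projT1 (s i)) (tF1 (projT2 (s i)))).
by exists i, j; split=> //; exists g; apply: tHom_eq.
Qed.

(** If no finite list were a basis, elements above none of those chosen before could be picked one
    after another, forming a bad sequence. *)
Lemma good_finite_basis (T : Type) (le : T -> T -> Prop) : (forall s, good le s) ->
  exists fs : seq T, forall y, exists x, List.In x fs /\ le x y.
Proof.
move=> H; apply: NNPP => nb.
have {}nb fs : exists y, forall x, List.In x fs -> ~ le x y.
  apply: NNPP => ny; apply: nb; exists fs => y; apply: NNPP => nx; apply: ny; exists y => x xfs xy.
  by apply: nx; exists x.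
pose nx fs := sval (constructive_indefinite_description _ (nb fs)).
have nxP fs x : List.In x fs -> ~ le x (nx fs) := svalP (constructive_indefinite_description _ (nb fs)) x.
pose L := fix L n := if n is n'.+1 then nx (L n') :: L n' else [::].
have [i [j [ij]]] := H (fun n => nx (L n)); apply: nxP.
elim: j ij => // j IH; rewrite ltnS leq_eqVlt => /orP[/eqP ->|/IH]; [by left | by right].
Qed.

(* C(numOp_(g,n))^op is quasi-Groebner. *)
Theorem theorem3p13 :
  exists (C : Category) (F0 : Ob C -> ograph)
         (F1 : forall a b : Ob C, Hom a b -> Dhom (F0 a) (F0 b)),
    groebner C /\ is_functorD F1 /\ ess_surjD F0 /\ propertyF_D F1.
Proof.
exists tCat, tF0, tF1; split; [|split; [|split]].
- by move=> c; split; [exact: tCat_admissible | exact: tCat_noetherian].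
- by split.
- case=> q vq; have [c cE] := tgraph_exists vq; subst q; exists c.
  have -> : exist _ (tgr c) vq = tF0 c by apply/val_inj.
  (* Every graph underlies some object, so the isomorphism can be an identity. *)
  exists (tF1 (tid c)), (tF1 (tid c)).
  by have := congr1 sval (tcomp1l (tid c)); split.
- move=> d; have [fs H] := good_finite_basis (@factors_good d).
  exists fs => c f; have [x [xfs [g gE]]] := H (existT _ c f).
  by exists x; split=> //; exists g.
Qed.
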